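(* Let $m\ge 3$ be an integer, let $c>0$ and $\lambda>0$, and let $\mathbf X(t)=(X_1(t),\dots,X_m(t))$, $t>0$, be the $m$-dimensional symmetric Markov random flight with speed $c$ and switching intensity $\lambda$. Let $\mu_{(2,2,0,\dots,0)}(t)=\mathbb E\left[X_1(t)^2X_2(t)^2\right]$ be its 2-marginal second moment function. Then for every $t>0$, $$\mu_{(2,2,0,\dots,0)}(t)=\frac{8c^4}{m^2(m+2)\lambda^4}\left\{ m\left[e^{-\lambda t}\left(\lambda^2t^2+3\lambda t+3\right)+\frac{\lambda^2t^2}{2}-3\right]+(\lambda^2t^2+12)(1-e^{-\lambda t})-6\lambda t(1+e^{-\lambda t})\right\}.$$
   Context: The $m$-dimensional symmetric Markov random flight with speed $c>0$ and switching intensity $\lambda>0$ is the following process. A particle starts at the origin of $\mathbb R^m$ at time $0$ and moves with constant speed $c$. Let $0=\tau_0<\tau_1<\tau_2<\dots$, where $\tau_1,\tau_2,\dots$ are the jump times of a homogeneous Poisson process $N(t)$ of rate $\lambda$, and let $U_0,U_1,U_2,\dots$ be independent random vectors, independent of the Poisson process, each uniformly distributed on the unit sphere $\{\mathbf x\in\mathbb R^m:\|\mathbf x\|=1\}$. The particle moves in direction $U_j$ during the time interval $[\tau_j,\tau_{j+1})$, so that its position at time $t$ is $$\mathbf X(t)=c\sum_{j=0}^{N(t)-1}(\tau_{j+1}-\tau_j)U_j+c\,(t-\tau_{N(t)})U_{N(t)}.$$ For a multi-index $\mathbf q=(q_1,\dots,q_m)$ the moment function is $\mu_{\mathbf q}(t)=\mathbb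 E\left[X_1(t)^{q_1}\cdots X_m(t)^{q_m}\right]$. *)

(* Defs.v *)
From HB Require Import structures.
From mathcomp Require Export all_boot all_order all_algebra.
From mathcomp Require Export finmap.
From mathcomp Require Export all_classical all_reals all_analysis.
Export Order.TTheory GRing.Theory Num.Theory.
Export numFieldNormedType.Exports.

Set Implicit Arguments.
Unset Strict Implicit.
Unset Printing Implicit Defensive.

Global Open Scope classical_set_scope.
Global Open Scope ring_scope.

Section Euclidean.
Context {R : realType} {m : nat}.
Implicit Types (x y : 'rV[R]_m) (A : set 'rV[R]_m).

(* The library norm on ['rV[R]_m] is the sup norm, whence [enorm]. *)
Definition enorm x : R := Num.sqrt (\sum_i x ord0 i ^+ 2).

Definition esphere : set 'rV[R]_m := [set x | enorm x = 1].

(* 0 is added so that the empty set has diameter 0. *)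
Definition ediam A : \bar R :=
  ereal_sup (0%E |` [set (enorm (x - y))%:E | x in A & y in A]).

Definition hausdorff_premeasure (k : nat) (delta : R) A : \bar R :=
  ereal_inf [set (\sum_(n <oo) ediam (C n) ^+ k)%E | C in
    [set C : (set 'rV[R]_m)^nat |
      A `<=` \bigcup_n C n /\ forall n, (ediam (C n) <= delta%:E)%E]].

(* k-dimensional Hausdorff (outer) measure for the Euclidean distance, k > 0,
   without the constant that normalizes it to agree with Lebesgue measure. *)
Definition hausdorff_measure (k : nat) A : \bar R :=
  ereal_sup [set hausdorff_premeasure k delta A | delta in [set e : R | 0 < e]].

End Euclidean.
Arguments esphere : clear implicits.

(* The generating topology is induced by the sup norm, i.e., it is the
   Euclidean one. *)
Definition borel_rV (R : realType) (m : nat) :=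
  g_sigma_algebraType (@open 'rV[R]_m).

Section Independence.
Context d (T : measurableType d) (R : realType) (P : probability T R).

Definition independent2 (F G : set_system T) : Prop :=
  forall A B, F A -> G B -> P (A `&` B) = (P A * P B)%E.

Definition independent_family (I : choiceType) (F : I -> set_system T) : Prop :=
  forall (J : {fset I}) (A : I -> set T), (forall i, i \in J -> F i (A i)) ->
    P (\bigcap_(i in [set` J]) A i) = (\prod_(i <- J) P (A i))%E.

Definition sigma_of_process d' (T' : measurableType d') (I : Type) (D : set I)
    (X : I -> T -> T') : set_system T :=
  <<s \bigcup_(i in D) g_sigma_algebra_preimage (X i) >>.

End Independence.

Section RandomFlight.
Context d (T : measurableType d) (R : realType) (P : probability T R).

(* Time is the half-line [0, +oo[; the values [N t] for t < 0 play no role. *)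
Record poisson_process (lambda : R) (N : R -> {RV P >-> nat}) : Prop := {
  poisson_process_start : forall w, N 0 w = 0%N ;
  poisson_process_nondecreasing : forall (s t : R) w,
    0 <= s -> s <= t -> (N s w <= N t w)%N ;
  poisson_process_increments : forall t : nat -> R,
    0 <= t 0%N -> {homo t : i j / (i <= j)%N >-> i <= j} ->
    independent_family P (fun i : nat =>
      g_sigma_algebra_preimage (fun w => (N (t i.+1) w - N (t i) w)%N)) ;
  poisson_process_law : forall (s t : R) (k : nat), 0 <= s -> s < t ->
    P [set w | (N t w - N s w)%N = k] =
      (poisson_pmf (lambda * (t - s)) k)%:E }.

(* [tau n.+1 w] is the time of the (n+1)-st jump of the path of N. *)
Record jump_times (N : R -> T -> nat) (tau : nat -> T -> R) : Prop := {
  jump_times0 : forall w, tau 0%N w = 0 ;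
  jump_times_increasing : forall n w, tau n w < tau n.+1 w ;
  jump_times_count : forall (t : R) w (n : nat), 0 <= t ->
    (N t w = n <-> tau n w <= t < tau n.+1 w) }.

(* Uniform distribution on the sphere: normalized surface measure, i.e.,
   normalized (m-1)-dimensional Hausdorff measure. *)
Definition uniform_on_sphere m (X : {RV P >-> borel_rV R m}) : Prop :=
  forall A : set (borel_rV R m), measurable A ->
    distribution P X A =
      (hausdorff_measure m.-1 (esphere R m `&` A) /
       hausdorff_measure m.-1 (esphere R m))%E.

Record random_flight m (lambda : R) (N : R -> {RV P >-> nat})
    (tau : nat -> T -> R) (U : nat -> {RV P >-> borel_rV R m}) : Prop := {
  random_flight_poisson : poisson_process lambda N ;
  random_flight_jumps : jump_times N tau ;
  random_flight_uniform : forall j, uniform_on_sphere (U j) ;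
  random_flight_directions :
    independent_family P (fun j => g_sigma_algebra_preimage (U j)) ;
  random_flight_independent :
    independent2 P (sigma_of_process [set: nat] U)
                   (sigma_of_process [set t : R | 0 <= t] N) }.

Definition flight_position m (c : R) (N : R -> T -> nat) (tau : nat -> T -> R)
    (U : nat -> T -> 'rV[R]_m) (t : R) (w : T) : 'rV[R]_m :=
  c *: (\sum_(0 <= j < N t w) (tau j.+1 w - tau j w) *: U j w)
  + (c * (t - tau (N t w) w)) *: U (N t w) w.

Definition moment m (X : T -> 'rV[R]_m) (q : 'I_m -> nat) : \bar R :=
  'E_P[fun w => \prod_(i < m) X w ord0 i ^+ q i].

End RandomFlight.

(* Main.v *)
Require Import Defs.
From mathcomp Require Import measurable_realfun ring lra.

(** Up to time [t] the particle travels finitely many segments, of durations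
    [L_0, ..., L_n] adding up to [t], in the directions [U_0, ..., U_n], so that
    [X_k = c \sum_j L_j U_(j,k)].  Expanding [X_1 ^ 2 X_2 ^ 2] gives a sum over
    quadruples of segments, in which the directions are independent of the
    durations and of each other.

    The law of a direction is invariant under reflections, because the Hausdorff
    measure is invariant under Euclidean isometries.  Sign changes kill the
    moments with an odd exponent, and exchanges of coordinates together with one
    rational reflection determine the others from [\sum_k U_k ^ 2 = 1]: the mean
    of [U_1 ^ 2] is [1 / m] and that of [U_1 ^ 2 U_2 ^ 2] is [1 / (m (m + 2))].
    Averaging over the directions therefore leaves
    [c ^ 4 (S2 ^ 2 / m ^ 2 + (1 / (m (m + 2)) - 1 / m ^ 2) S4)], where [Sp] is the
    sum of the [p]-th powers of the durations (lemma [integral_flight]).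

    The means of [S2 ^ 2] and [S4] are computed without the joint law of the
    jump times.  Let [a] be the time since the last jump.  Along each path, [S4]
    is the integral of [4 a ^ 3], [S2] that of [2 a], and [S2 ^ 2] that of
    [4 a S2]; moreover [a ^ p] at time [s] is the integral of
    [p (s - u) ^ (p - 1)], and [a S2] that of [S2 + 2 a ^ 2], over the times [u]
    with no jump between [u] and [s] ([integral_along_path]).  By Tonelli's
    theorem all means become iterated integrals of probabilities that one or two
    disjoint intervals contain no jump, which are exponentials
    ([mean_time_integral], [mean_nojump2]). *)

Set Implicit Arguments.
Unset Strict Implicit.
Unset Printing Implicit Defensive.
Local Open Scope classical_set_scope.
Local Open Scope ring_scope.

(** * Means of bounded measurable functions *)

(** Bounded measurable functions are integrable for every probability and stable
    under products, which removes all integrability side conditions below. *)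
Definition bdd_measurable d (T : measurableType d) (R : realType) (f : T -> R) :=
  measurable_fun setT f /\ exists M : R, forall x, `|f x| <= M.

Section BddMeasurable.
Context d (T : measurableType d) (R : realType).
Implicit Types f g : T -> R.

Lemma bdd_cst (k : R) : bdd_measurable (fun _ : T => k).
Proof. by split; [exact: measurable_cst | exists `|k|]. Qed.

Lemma bdd_indic (A : set T) : measurable A -> bdd_measurable (\1_A : T -> R).
Proof.
move=> mA; split; first exact: measurable_indic.
by exists 1 => x; rewrite indicE; case: (x \in A); rewrite ?normr1 ?normr0.
Qed.

Lemma bddD f g : bdd_measurable f -> bdd_measurable g ->
  bdd_measurable (fun x => f x + g x).
Proof.
move=> [mf [M fM]] [mg [K gK]]; split; first exact: measurable_funD.
by exists (M + K) => x; rewrite (le_trans (ler_normD _ _))// lerD.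
Qed.

Lemma bddM f g : bdd_measurable f -> bdd_measurable g ->
  bdd_measurable (fun x => f x * g x).
Proof.
move=> [mf [M fM]] [mg [K gK]]; split; first exact: measurable_funM.
by exists (M * K) => x; rewrite normrM ler_pM.
Qed.

Lemma bdd_comp d' (T' : measurableType d') (h : T' -> T) f :
  measurable_fun setT h -> bdd_measurable f -> bdd_measurable (fun x => f (h x)).
Proof.
move=> mh [mf [M fM]]; split; first exact: (measurableT_comp mf mh).
by exists M => x.
Qed.

Lemma bdd_sum (I : Type) (s : seq I) (F : I -> T -> R) :
  (forall i, bdd_measurable (F i)) -> bdd_measurable (fun x => \sum_(i <- s) F i x).
Proof.
move=> bF; elim: s => [|i s IH].
  rewrite (_ : (fun _ => _) = (fun=> 0)); first exact: bdd_cst.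
  by apply/funext => x; rewrite big_nil.
rewrite (_ : (fun _ => _) = (fun x => F i x + \sum_(j <- s) F j x)).
  exact: bddD.
by apply/funext => x; rewrite big_cons.
Qed.

Lemma bdd_prod (I : Type) (s : seq I) (Q : pred I) (F : I -> T -> R) :
  (forall i, bdd_measurable (F i)) ->
  bdd_measurable (fun x => \prod_(i <- s | Q i) F i x).
Proof.
move=> bF; elim: s => [|i s IH].
  rewrite (_ : (fun _ => _) = (fun=> 1)); first exact: bdd_cst.
  by apply/funext => x; rewrite big_nil.
rewrite (_ : (fun _ => _) =
    (fun x => (if Q i then F i x else 1) * \prod_(j <- s | Q j) F j x)).
  by apply: bddM => //; case: (Q i) => //; exact: bdd_cst.
by apply/funext => x; rewrite big_cons; case: (Q i); rewrite ?mul1r.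
Qed.

End BddMeasurable.

Section Mean.
Import HBNNSimple.
Context d (T : measurableType d) (R : realType) (P : probability T R).
Implicit Types f g : T -> R.

Definition mean f : R := Rintegral P setT f.

Lemma bdd_integrable f : bdd_measurable f -> P.-integrable setT (EFin \o f).
Proof.
move=> [mf [M fM]].
apply: (@le_integrable _ _ _ P _ measurableT _ (EFin \o cst M)).
- exact/measurable_EFinP.
- by move=> x _ /=; rewrite lee_fin (le_trans (fM x))// ler_norm.
- exact: finite_measure_integrable_cst.
Qed.

Lemma meanE f : bdd_measurable f -> (\int[P]_x (f x)%:E = (mean f)%:E)%E.
Proof.
by move=> /bdd_integrable bf; rewrite /mean /Rintegral fineK// integrable_fin_num.
Qed.

Lemma mean_cst (k : R) : mean (fun=> k) = k.
Proof.
have PT := @probability_setT _ _ _ P.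
rewrite /mean Rintegral_cst//.
by rewrite /= PT mulr1.
Qed.

Lemma mean_indic (A : set T) : measurable A -> (mean \1_A)%:E = P A.
Proof.
by move=> mA; rewrite -meanE ?integral_indic ?setIT//; exact: bdd_indic.
Qed.

Lemma meanD f g : bdd_measurable f -> bdd_measurable g ->
  mean (fun x => f x + g x) = mean f + mean g.
Proof. by move=> bf bg; rewrite /mean RintegralD//; exact: bdd_integrable. Qed.

Lemma meanZ (k : R) f : bdd_measurable f -> mean (fun x => k * f x) = k * mean f.
Proof. by move=> bf; rewrite /mean RintegralZl//; exact: bdd_integrable. Qed.

Lemma mean_sum (I : Type) (s : seq I) (F : I -> T -> R) :
  (forall i, bdd_measurable (F i)) ->
  mean (fun x => \sum_(i <- s) F i x) = \sum_(i <- s) mean (F i).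
Proof.
move=> bF; elim: s => [|i s IH].
  rewrite big_nil -[RHS](mean_cst 0); congr mean.
  by apply/funext => x; rewrite big_nil.
rewrite big_cons -IH -meanD//; last exact: bdd_sum.
by congr mean; apply/funext => x; rewrite big_cons.
Qed.

(** Simple functions reduce the nonnegative case to indicators, with dominated
    convergence for the limit; adding a constant to [f] reduces the bounded case
    to the nonnegative one, since [V] itself has mean [0] (take [A = setT]). *)
Lemma mean_indic_orth d' (T' : measurableType d') (U : T -> T') (V : T -> R) :
  measurable_fun setT U -> bdd_measurable V ->
  (forall A, measurable A -> mean (fun w => \1_A (U w) * V w) = 0) ->
  forall f : T' -> R, bdd_measurable f -> mean (fun w => f (U w) * V w) = 0.
Proof.
move=> mU bV indV.
have ge0 (f : T' -> R) : bdd_measurable f -> (forall y, 0 <= f y) ->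
    mean (fun w => f (U w) * V w) = 0.
  move=> bf f0; have [mf [M fM]] := bf; have [mV [K VK]] := bV.
  have mf' : measurable_fun setT (EFin \o f) by exact/measurable_EFinP.
  pose g := nnsfun_approx measurableT mf'.
  have gf n y : g n y <= f y.
    rewrite -lee_fin.
    have := @cvg_nnsfun_approx _ _ _ _ measurableT _ mf' (fun y _ => f0 y) y I.
    move=> cg; rewrite -[leRHS](cvg_lim _ cg)//.
    have ndg : {homo (fun n => (g n y)%:E) : i j / (i <= j)%N >-> (i <= j)%E}.
      by move=> i j ij; rewrite lee_fin; exact/lefP/nd_nnsfun_approx.
    have /cvg_lim -> // := ereal_nondecreasing_cvgn ndg.
    by apply: ereal_sup_ubound; exists n.
  have bg n : bdd_measurable (g n).
    split; first exact: measurable_funP.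
    exists M => y; rewrite ger0_norm ?fun_ge0// (le_trans (gf n y))//.
    exact: le_trans (ler_norm _) (fM y).
  have g0 n : mean (fun w => g n (U w) * V w) = 0.
    have gE w : g n (U w) * V w =
        \sum_(x <- fset_set (range (g n))) x * (\1_(g n @^-1` [set x]) (U w) * V w).
      rewrite {1}(fimfunE (g n) (U w)) fsbig_finite//= mulr_suml.
      by apply: eq_bigr => x _; rewrite mulrA.
    under [X in mean X]funext do rewrite gE.
    have mg x : measurable (g n @^-1` [set x]) by exact: measurable_sfunP.
    have b1 x : bdd_measurable (fun w => \1_(g n @^-1` [set x]) (U w) * V w).
      by apply: bddM => //; apply: bdd_comp => //; exact: bdd_indic.
    rewrite mean_sum; last by move=> x; apply: bddM => //; exact: bdd_cst.
    by rewrite big1// => x _; rewrite meanZ// indV// mulr0.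
  have bfV : bdd_measurable (fun w => f (U w) * V w).
    by apply: bddM => //; exact: bdd_comp.
  have bgV n : bdd_measurable (fun w => g n (U w) * V w).
    by apply: bddM => //; exact: bdd_comp.
  have K0 : 0 <= K by exact: le_trans (VK point).
  have M0 : 0 <= M by exact: le_trans (fM point).
  have dct := @dominated_convergence _ _ _ P setT measurableT
    (fun n w => (g n (U w) * V w)%:E) (fun w => (f (U w) * V w)%:E)
    (EFin \o cst (M * K)).
  have [| | | | |_ _] := dct.
  - by move=> n; apply/measurable_EFinP; case: (bgV n).
  - by apply/measurable_EFinP; case: bfV.
  - apply: aeW => w _; under eq_fun do rewrite EFinM; rewrite EFinM.
    apply: cvgeZr => //.
    exact: (@cvg_nnsfun_approx _ _ _ _ measurableT _ mf' (fun y _ => f0 y) _ I).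
  - exact: finite_measure_integrable_cst.
  - apply: aeW => w n _ /=; rewrite lee_fin normrM ler_pM//.
    rewrite ger0_norm ?fun_ge0// (le_trans (gf n _))//.
    exact: le_trans (ler_norm _) (fM _).
  rewrite (_ : (fun _ => _) = (fun=> 0%E)); last first.
    by apply/funext => n /=; rewrite meanE// g0.
  move=> c0; apply/EFin_inj; rewrite -meanE//; apply/esym.
  by move: c0 => /cvg_lim <- //; rewrite lim_cst.
move=> f bf; have [_ [M fM]] := bf.
have V0 : mean V = 0.
  rewrite -(indV _ measurableT); congr mean.
  by apply/funext => w; rewrite indicT mul1r.
have bfM : bdd_measurable (fun y => f y + M) by apply: bddD => //; exact: bdd_cst.
have := ge0 _ bfM.
rewrite (_ : (fun _ => (_ + _) * _) = (fun w => f (U w) * V w + M * V w)); last first.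
  by apply/funext => w; rewrite mulrDl.
rewrite meanD; [|by apply: bddM => //; exact: bdd_comp
                |by apply: bddM => //; exact: bdd_cst].
rewrite meanZ// V0 mulr0 addr0; apply => y.
by rewrite -lerBlDr sub0r; have := fM y; rewrite ler_norml => /andP[].
Qed.

(** The form in which independence is used: the constant [C] is the mean of [W]
    conditionally on [U], and the hypothesis only has to be checked on events
    of [U].  Apply the previous lemma to [V = W - C]. *)
Lemma mean_indic_factor d' (T' : measurableType d') (U : T -> T') (W : T -> R)
    (C : R) :
  measurable_fun setT U -> bdd_measurable W ->
  (forall A, measurable A ->
    mean (fun w => \1_A (U w) * W w) = mean (fun w => \1_A (U w)) * C) ->
  forall f : T' -> R, bdd_measurable f ->
    mean (fun w => f (U w) * W w) = mean (fun w => f (U w)) * C.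
Proof.
move=> mU bW WC.
have bV : bdd_measurable (fun w => W w + - C) by apply: bddD => //; exact: bdd_cst.
have VE (f : T' -> R) : bdd_measurable f ->
    mean (fun w => f (U w) * (W w + - C)) =
    mean (fun w => f (U w) * W w) - mean (fun w => f (U w)) * C.
  move=> bf; have bfU : bdd_measurable (fun w => f (U w)) by exact: bdd_comp.
  rewrite [_ * C]mulrC -mulNr -meanZ// -meanD.
  - by congr mean; apply/funext => w; rewrite mulrDr [X in _ + X]mulrC.
  - exact: bddM.
  - by apply: bddM => //; exact: bdd_cst.
move=> f bf; apply/eqP; rewrite -subr_eq0 -VE//; apply/eqP.
apply: mean_indic_orth => // A mA.
by rewrite VE ?WC ?subrr//; exact: bdd_indic.
Qed.

(** With this map, a function measurable for a smaller sigma-algebra becomes a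
    function of a random variable. *)
Lemma measurable_fun_sub_sigma (F : set_system T) : F `<=` measurable ->
  measurable_fun setT (id : T -> g_sigma_algebraType F).
Proof.
move=> FT _ A mA; rewrite setTI preimage_id.
exact: (smallest_sub (@sigma_algebra_measurable _ T) FT).
Qed.

Lemma mean_indicM (A B : set T) : measurable A -> measurable B ->
  (mean (fun w => \1_A w * \1_B w))%:E = P (A `&` B).
Proof.
move=> mA mB; rewrite -mean_indic; last exact: measurableI.
by rewrite indicI.
Qed.

(** Replace the indicators in the product rule for events by [f], then by [g]. *)
Lemma mean_mul_independent2 (F G : set_system T) (f g : T -> R) :
  independent2 P <<s F >> <<s G >> -> F `<=` measurable -> G `<=` measurable ->
  bdd_measurable (f : g_sigma_algebraType F -> R) ->
  bdd_measurable (g : g_sigma_algebraType G -> R) ->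
  mean (fun w => f w * g w) = mean f * mean g.
Proof.
move=> FG FT GT bf bg.
have mF := measurable_fun_sub_sigma FT; have mG := measurable_fun_sub_sigma GT.
have bf' : bdd_measurable f by exact: (bdd_comp mF bf).
have subT (H : set_system T) : H `<=` measurable -> forall A, <<s H >> A -> measurable A.
  by move=> HT A; apply: (smallest_sub (@sigma_algebra_measurable _ T) HT).
have step B : <<s G >> B -> mean (fun w => f w * \1_B w) = mean f * mean \1_B.
  move=> sB; have mB : measurable B by exact: (subT G GT B sB).
  apply: (mean_indic_factor mF _ _ bf); first exact: bdd_indic.
  move=> A sA /=; have mA : measurable (A : set T) by exact: (subT F FT A sA).
  by apply/EFin_inj; rewrite EFinM mean_indicM// !mean_indic//; exact: FG.
under eq_fun do rewrite mulrC; rewrite [RHS]mulrC.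
apply: (mean_indic_factor mG bf' _ bg) => B mB /=.
by under eq_fun do rewrite mulrC; rewrite step// mulrC.
Qed.

Section ProductRule.
Context d' (T' : measurableType d') (U : nat -> T -> T').
Hypothesis mU : forall j, measurable_fun setT (U j).
Hypothesis indepU :
  independent_family P (fun j => g_sigma_algebra_preimage (U j)).

Lemma mean_prod_indic n (A : nat -> set T') : (forall j, measurable (A j)) ->
  mean (fun w => \prod_(j < n) \1_(A j) (U j w)) =
  \prod_(j < n) mean (fun w => \1_(A j) (U j w)).
Proof.
move=> mA.
have mUA j : measurable (U j @^-1` A j) by rewrite -[X in measurable X]setTI; exact: mU.
pose J := seq_fset tt (iota 0 n).
have inJ j : (j \in J) = (j < n)%N by rewrite seq_fsetE mem_iota.
have prodJ : (\prod_(i <- J) P (U i @^-1` A i))%E =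
    (\prod_(j < n) mean (fun w => \1_(A j) (U j w)))%:E.
  rewrite (perm_big _ (seq_fset_perm _ _)) undup_id ?iota_uniq//=.
  rewrite -(big_mkord xpredT (fun j => mean (fun w => \1_(A j) (U j w)))).
  rewrite /index_iota subn0 -prodEFin; apply: eq_bigr => j _.
  by rewrite -mean_indic.
have := @indepU J (fun j => U j @^-1` A j).
rewrite prodJ => indJ; apply/EFin_inj; rewrite -indJ; last first.
  by move=> i _; exists (A i) => //; rewrite setTI.
rewrite -mean_indic; last first.
  by apply: fin_bigcap_measurable => //; exact: finite_fset.
congr (mean _)%:E; apply/funext => w.
have [all1|] := pselect (forall j : 'I_n, A j (U j w)).
  rewrite big1 => [|j _]; last by rewrite indicE mem_set//; exact: all1.
  by rewrite indicE mem_set// => j /=; rewrite inJ => jn; exact: (all1 (Ordinal jn)).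
move=> nall; have [j nj] : exists j : 'I_n, ~ A j (U j w).
  by apply: contrapT => /forallNP nA; apply: nall => j; exact: contrapT (nA j).
rewrite (bigD1 j)//= indicE memNset// mul0r indicE memNset//.
by move=> /(_ (j : nat)); rewrite /= inJ ltn_ord => /(_ isT).
Qed.

(** Induction on the number [k] of leading factors that are not indicators: with
    the other factors fixed, the product rule for arbitrary bounded [f k] follows
    from the rule for indicators in its place. *)
Lemma mean_prod_independent n (f : nat -> T' -> R) :
  (forall j, bdd_measurable (f j)) ->
  mean (fun w => \prod_(j < n) f j (U j w)) =
  \prod_(j < n) mean (fun w => f j (U j w)).
Proof.
move=> bf.
suff claim k (h : nat -> T' -> R) : (k <= n)%N ->
    (forall j, bdd_measurable (h j)) ->
    (forall j, (k <= j)%N -> exists2 A, measurable A & h j = \1_A) ->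
    mean (fun w => \prod_(j < n) h j (U j w)) =
    \prod_(j < n) mean (fun w => h j (U j w)).
  pose h j := if (j < n)%N then f j else \1_setT.
  have := claim n h (leqnn n).
  rewrite (_ : (fun w => _) = (fun w => \prod_(j < n) f j (U j w))); last first.
    by apply/funext => w; apply: eq_bigr => j _; rewrite /h ltn_ord.
  move=> -> //.
  - by apply: eq_bigr => j _; rewrite /h ltn_ord.
  - by move=> j; rewrite /h; case: ifP => // _; exact: bdd_indic.
  - by move=> j nj; exists setT => //; rewrite /h ltnNge nj.
elim: k h => [|k IH] h kn bh ih.
  have /choice[A hA] : forall j, exists A, measurable A /\ h j = \1_A.
    by move=> j; have [A mA hA] := ih j (leq0n j); exists A.
  rewrite (_ : h = fun j => \1_(A j)); last by apply/funext => j; case: (hA j).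
  by apply: mean_prod_indic => j; case: (hA j).
pose ok := Ordinal kn.
(* The family h with B in place k. *)
pose h' (B : T' -> R) j := if j == k then B else h j.
have bh' B : bdd_measurable B -> forall j, bdd_measurable (h' B j).
  by move=> bB j; rewrite /h'; case: eqP.
have splitB B : mean (fun w => \prod_(j < n) h' B j (U j w)) =
    mean (fun w => B (U k w) * \prod_(j < n | j != ok) h j (U j w)).
  congr mean; apply/funext => w; rewrite (bigD1 ok)//= /h' eqxx; congr (_ * _).
  by apply: eq_bigr => j; rewrite -val_eqE /= => /negbTE ->.
have splitC B : \prod_(j < n) mean (fun w => h' B j (U j w)) =
    mean (fun w => B (U k w)) * \prod_(j < n | j != ok) mean (fun w => h j (U j w)).
  rewrite (bigD1 ok)//= {1}/h' eqxx; congr (_ * _).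
  by apply: eq_bigr => j; rewrite /h' -val_eqE /= => /negbTE ->.
have hE : h = h' (h k) by apply/funext => j; rewrite /h'; case: eqP => // ->.
rewrite hE splitB splitC.
apply: mean_indic_factor => //.
  by apply: bdd_prod => j; apply: bdd_comp.
move=> A mA; rewrite -splitB -splitC; apply: IH.
- exact: ltnW.
- by apply: bh'; exact: bdd_indic.
- move=> j; rewrite leq_eqVlt => /orP[/eqP <-|kj].
    by exists A => //; rewrite /h' eqxx.
  by rewrite /h' gtn_eqF//; exact: ih.
Qed.

End ProductRule.

End Mean.

Lemma mean_eq_law d (T : measurableType d) (R : realType) (P : probability T R)
    d' (T' : measurableType d') (X Y : T -> T') :
  measurable_fun setT X -> measurable_fun setT Y ->
  (forall A, measurable A -> P (X @^-1` A) = P (Y @^-1` A)) ->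
  forall f : T' -> R, bdd_measurable f ->
    mean P (fun w => f (X w)) = mean P (fun w => f (Y w)).
Proof.
move=> mX mY XY f bf; have [_ [M fM]] := bf.
(* The shift by M makes the integrand nonnegative. *)
pose g y := f y + M.
have bg : bdd_measurable g by apply: bddD => //; exact: bdd_cst.
have gE : mean P (fun w => g (X w)) = mean P (fun w => g (Y w)).
  have g0 y : (0 <= (g y)%:E)%E.
    by rewrite lee_fin /g -lerBlDr sub0r; have := fM y; rewrite ler_norml => /andP[].
  have mg : measurable_fun setT (fun y => (g y)%:E).
    by apply/measurable_EFinP; case: bg.
  have bgc (Z : T -> T') : measurable_fun setT Z -> bdd_measurable (fun w => g (Z w)).
    by move=> mZ; exact: bdd_comp.
  apply/EFin_inj; rewrite -!meanE//; [|exact: bgc|exact: bgc].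
  rewrite -[LHS](@ge0_integral_pushforward _ _ _ _ _ _ mX P setT (fun y => (g y)%:E))//.
  rewrite -[RHS](@ge0_integral_pushforward _ _ _ _ _ _ mY P setT (fun y => (g y)%:E))//.
  by apply: eq_measure_integral => A mA _; exact: XY.
move: gE; rewrite /g !meanD; try by [exact: bdd_comp|exact: bdd_cst].
exact: addIr.
Qed.

(** * The uniform law on the sphere: reflections and moments *)

Section Isometry.
Context {R : realType} {m : nat} (g : 'rV[R]_m -> 'rV[R]_m).
Hypothesis giso : forall x y, enorm (g x - g y) = enorm (x - y).

Lemma ediam_isometry (A : set 'rV[R]_m) : ediam (g @` A) = ediam A.
Proof.
rewrite /ediam; congr (ereal_sup (_ |` _)); apply/seteqP; split.
  by move=> _ [_ [x Ax <-] [_ [y Ay <-]]] <-; exists x => //; exists y => //; rewrite giso.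
move=> _ [x Ax [y Ay]] <-; exists (g x); first by exists x.
by exists (g y); [exists y|rewrite giso].
Qed.

(** The images of the sets of a cover form a cover with the same diameters. *)
Lemma hausdorff_measure_isometry_le k (A : set 'rV[R]_m) :
  (hausdorff_measure k (g @` A) <= hausdorff_measure k A)%E.
Proof.
apply: ge_ereal_sup => _ [delta /= d0 <-].
apply: (@le_trans _ _ (hausdorff_premeasure k delta A)); last first.
  by apply: ereal_sup_ubound; exists delta.
apply: le_ereal_inf => _ [C [AC Cd] <-].
exists (fun n => g @` C n); last by apply: eq_eseriesr => n _; rewrite ediam_isometry.
split; last by move=> n; rewrite ediam_isometry.
move=> _ [x /AC [n _ Cnx] <-]; by exists n => //; exists x.
Qed.

End Isometry.

Section Reflection.
Context {R : realType} {m : nat}.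
Implicit Types (x y w : 'rV[R]_m).

Definition dot x y : R := \sum_i x ord0 i * y ord0 i.

(** Reflection in the hyperplane orthogonal to [w]. *)
Definition reflection w x : 'rV[R]_m := x - (2 * dot x w / dot w w) *: w.

Lemma dotC x y : dot x y = dot y x.
Proof. by apply: eq_bigr => i _; rewrite mulrC. Qed.

Lemma dotDl x y z : dot (x + y) z = dot x z + dot y z.
Proof. by rewrite /dot -big_split/=; apply: eq_bigr => i _; rewrite mxE mulrDl. Qed.

Lemma dotZl (k : R) x y : dot (k *: x) y = k * dot x y.
Proof. by rewrite /dot mulr_sumr; apply: eq_bigr => i _; rewrite mxE mulrA. Qed.

Lemma dotBl x y z : dot (x - y) z = dot x z - dot y z.
Proof. by rewrite dotDl -scaleN1r dotZl mulN1r. Qed.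

Lemma dotBr x y z : dot z (x - y) = dot z x - dot z y.
Proof. by rewrite dotC dotBl !(dotC z). Qed.

Lemma dotZr (k : R) x y : dot y (k *: x) = k * dot y x.
Proof. by rewrite dotC dotZl (dotC y). Qed.

Lemma enormE x : enorm x = Num.sqrt (dot x x).
Proof. by congr Num.sqrt; apply: eq_bigr => i _; rewrite expr2. Qed.

Variable (w : 'rV[R]_m).
Hypothesis w0 : dot w w != 0.

Lemma reflectionB x y : reflection w (x - y) = reflection w x - reflection w y.
Proof.
by rewrite /reflection dotBl; apply/rowP => i; rewrite !mxE; ring.
Qed.

Lemma reflection_dot x : dot (reflection w x) (reflection w x) = dot x x.
Proof.
by rewrite /reflection !(dotBl, dotBr, dotZl, dotZr) [dot w x]dotC; field.
Qed.

Lemma reflectionK : involutive (reflection w).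
Proof.
move=> x; rewrite {1}/reflection.
have -> : dot (reflection w x) w = - dot x w.
  by rewrite /reflection dotBl dotZl; field.
by rewrite /reflection mulrN mulNr scaleNr opprK subrK.
Qed.

Lemma enorm_reflection x : enorm (reflection w x) = enorm x.
Proof. by rewrite !enormE reflection_dot. Qed.

Lemma continuous_dot : continuous (dot ^~ w).
Proof.
move=> x; rewrite /dot; elim: (index_enum _) => [|i s IH].
  by under eq_fun do rewrite big_nil; exact: cst_continuous.
under eq_fun do rewrite big_cons.
apply: (@continuousD _ _ _ (fun y : 'rV[R]_m => y ord0 i * w ord0 i)) => //.
apply: (@continuousM _ _ (fun y : 'rV[R]_m => y ord0 i) (fun=> w ord0 i)).
  exact: coord_continuous.
exact: cst_continuous.
Qed.

Lemma continuous_reflection : continuous (reflection w).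
Proof.
pose f (y : 'rV[R]_m) := (2 * dot y w / dot w w) *: w.
have -> : reflection w = (fun y => y) \- f by apply/funext.
move=> x; have cid : {for x, continuous (fun y : 'rV[R]_m => y)} by [].
suff cf : {for x, continuous f} by exact: continuousB cid cf.
apply: (@continuousZr_tmp _ _ _ (fun y => 2 * dot y w / dot w w) w).
apply: (@continuousM _ _ (fun y => 2 * dot y w) (fun=> (dot w w)^-1)); last exact: cst_continuous.
apply: (@continuousM _ _ (fun=> 2) (dot ^~ w)); first exact: cst_continuous.
exact: continuous_dot.
Qed.

(** The reflection preserves the sphere and is its own inverse, so the preceding
    inequality can be applied in both directions. *)
Lemma hausdorff_measure_reflection k (A : set 'rV[R]_m) :
  hausdorff_measure k (esphere R m `&` reflection w @^-1` A) =
  hausdorff_measure k (esphere R m `&` A).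
Proof.
have iso x y : enorm (reflection w x - reflection w y) = enorm (x - y).
  by rewrite -reflectionB enorm_reflection.
have imE B : reflection w @` (esphere R m `&` B) =
    esphere R m `&` reflection w @^-1` B.
  apply/seteqP; split => [_ [x [Sx Bx] <-]|x [Sx Bx]].
    by split; rewrite /= ?reflectionK// /esphere /= enorm_reflection.
  exists (reflection w x); rewrite ?reflectionK//.
  by split => //; rewrite /esphere /= enorm_reflection.
apply/eqP; rewrite eq_le; apply/andP; split.
  by rewrite -imE; exact: hausdorff_measure_isometry_le.
rewrite -[X in esphere R m `&` X](_ : reflection w @^-1` (reflection w @^-1` A) = A).
  by rewrite -imE; exact: hausdorff_measure_isometry_le.
by apply/funext => x; rewrite /preimage /= reflectionK.
Qed.

End Reflection.

Section BorelRow.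
Context {R : realType} {m : nat}.

Lemma open_borel_rV (A : set (borel_rV R m)) : open (A : set 'rV[R]_m) -> measurable A.
Proof. by move=> oA; exact: sub_sigma_algebra. Qed.

Lemma continuous_borel_rV (f : 'rV[R]_m -> R) : continuous f ->
  measurable_fun setT (f : borel_rV R m -> R).
Proof.
move=> /continuousP cf; apply: (measurability _ (RGenOpens.measurableE R)) => _ [_ [a [b ->] <-]].
by rewrite setTI; apply: open_borel_rV; apply: cf; exact: interval_open.
Qed.

Lemma continuous_borel_rV_endo (f : 'rV[R]_m -> 'rV[R]_m) : continuous f ->
  measurable_fun setT (f : borel_rV R m -> borel_rV R m).
Proof.
move=> /continuousP cf; apply: (@measurability _ _ (borel_rV R m) (borel_rV R m) setT f
  (@open 'rV[R]_m)) => // _ [A oA <-].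
by rewrite setTI; apply: open_borel_rV; exact: cf.
Qed.

Lemma measurable_coord (i : 'I_m) :
  measurable_fun setT (fun x : borel_rV R m => (x : 'rV[R]_m) ord0 i).
Proof. by apply: continuous_borel_rV; exact: coord_continuous. Qed.

Lemma esphereE : esphere R m = [set x | \sum_i x ord0 i ^+ 2 = 1].
Proof.
rewrite /esphere /enorm; apply/seteqP; split => x /=.
  move=> s1; rewrite -[LHS]sqr_sqrtr ?s1 ?expr1n// sumr_ge0// => i _; exact: sqr_ge0.
by move=> ->; rewrite sqrtr1.
Qed.

Lemma measurable_esphere : measurable (esphere R m : set (borel_rV R m)).
Proof.
rewrite esphereE.
rewrite [X in measurable X](_ : _ = setT `&`
    (fun x : borel_rV R m => \sum_i (x : 'rV[R]_m) ord0 i ^+ 2) @^-1` [set 1]).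
  have mf : measurable_fun setT (fun x : borel_rV R m => \sum_i (x : 'rV[R]_m) ord0 i ^+ 2).
    by apply: measurable_sum => i; apply: measurable_funX; exact: measurable_coord.
  exact: mf.
by rewrite setTI.
Qed.

End BorelRow.

Section UniformMoments.
Context d (T : measurableType d) (R : realType) (P : probability T R) (m : nat).
Variable X : {RV P >-> borel_rV R m}.
Hypothesis unifX : uniform_on_sphere X.

(** The quotient of the Hausdorff measure of the sphere by itself is the total mass
    of the law of [X], hence [1]. *)
Lemma uniform_sphere_as : P (X @^-1` esphere R m) = 1%E.
Proof.
have := unifX (@measurable_esphere R m); rewrite {1}/distribution /= /pushforward => ->.
rewrite setIid -[X in (hausdorff_measure _ X / _)%E]setIT -(unifX measurableT).
by rewrite /distribution /= /pushforward preimage_setT probability_setT.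
Qed.

Lemma uniform_reflection (w : 'rV[R]_m) : dot w w != 0 ->
  forall f : borel_rV R m -> R, bdd_measurable f ->
    mean P (fun s => f (reflection w (X s))) = mean P (fun s => f (X s)).
Proof.
move=> w0 f bf.
have mr : measurable_fun setT (reflection w : borel_rV R m -> borel_rV R m).
  by apply: continuous_borel_rV_endo; exact: continuous_reflection.
have mX : measurable_fun setT X by exact: measurable_funP.
apply: (@mean_eq_law _ _ _ P _ (borel_rV R m) (fun s => reflection w (X s)) X) => //.
  exact: (measurableT_comp mr mX).
move=> A mA.
have mrA : measurable (reflection w @^-1` A : set (borel_rV R m)).
  by rewrite -[X in measurable X]setTI; exact: mr.
have := unifX mrA; rewrite hausdorff_measure_reflection// -unifX//.
Qed.

(** The values of a uniform vector lie on the sphere only almost surely; the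
    indicator makes polynomials bounded everywhere. *)
Definition sphere_fun (g : 'rV[R]_m -> R) (x : borel_rV R m) : R :=
  \1_(esphere R m) x * g x.

Lemma esphere_coord (x : 'rV[R]_m) i : esphere R m x -> `|x ord0 i| <= 1.
Proof.
rewrite esphereE /= => sx; rewrite -(@ler_sqr _ `|_|) ?nnegrE// expr1n real_normK ?num_real//.
by rewrite -sx (bigD1 i)//= lerDl sumr_ge0// => k _; exact: sqr_ge0.
Qed.

Lemma bdd_sphere_monomial p q i j :
  bdd_measurable (sphere_fun (fun x => x ord0 i ^+ p * x ord0 j ^+ q)).
Proof.
split.
  apply: measurable_funM; first by apply: measurable_indic; exact: measurable_esphere.
  by apply: measurable_funM; apply: measurable_funX; exact: measurable_coord.
exists 1 => x; rewrite /sphere_fun indicE; have [xS|_] := boolP (x \in esphere R m); last first.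
  by rewrite mul0r normr0.
have xl l : `|(x : 'rV[R]_m) ord0 l| <= 1 by apply: esphere_coord; rewrite inE in xS.
by rewrite mul1r normrM !normrX mulr_ile1// ?exprn_ge0// exprn_ile1.
Qed.

Definition sphere_moment p q i j :=
  mean P (fun s => sphere_fun (fun x => x ord0 i ^+ p * x ord0 j ^+ q) (X s)).

Lemma mean_sphere_poly (I : Type) (s : seq I) (c : I -> R) (p q : I -> nat)
    (i j : I -> 'I_m) :
  mean P (fun s0 => sphere_fun (fun x =>
    \sum_(l <- s) c l * (x ord0 (i l) ^+ p l * x ord0 (j l) ^+ q l)) (X s0)) =
  \sum_(l <- s) c l * sphere_moment (p l) (q l) (i l) (j l).
Proof.
have mX : measurable_fun setT X by exact: measurable_funP.
have bm l : bdd_measurable (fun s => sphere_fun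
    (fun x => x ord0 (i l) ^+ p l * x ord0 (j l) ^+ q l) (X s)).
  by apply: (bdd_comp mX); exact: bdd_sphere_monomial.
under [RHS]eq_bigr do rewrite -meanZ//.
rewrite -mean_sum; last by move=> l; apply: bddM => //; exact: bdd_cst.
congr mean; apply/funext => s0; rewrite /sphere_fun mulr_sumr.
by apply: eq_bigr => l _; rewrite mulrCA.
Qed.

(** Reflection in the hyperplane orthogonal to [e_i + k e_j]: it changes the sign
    of coordinate [i] for [k = 0], exchanges [i] and [j] for [k = -1], and for
    [k = -2] has the matrix entries [3/5] and [4/5], avoiding square roots. *)
Lemma sphere_moment_reflection (k : R) p q i j : i != j ->
  sphere_moment p q i j =
  mean P (fun s => sphere_fun (fun x =>
    (x ord0 i - 2 * (x ord0 i + k * x ord0 j) / (1 + k ^+ 2)) ^+ p *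
    (x ord0 j - 2 * (x ord0 i + k * x ord0 j) / (1 + k ^+ 2) * k) ^+ q) (X s)).
Proof.
move=> ij; pose w : 'rV[R]_m := delta_mx ord0 i + k *: delta_mx ord0 j.
have wE l : w ord0 l = (l == i)%:R + k * (l == j)%:R by rewrite !mxE /=.
have dotw x : dot x w = x ord0 i + k * x ord0 j.
  rewrite /dot (bigD1 i)//= (bigD1 j) 1?eq_sym//= !wE !eqxx (negbTE ij) eq_sym (negbTE ij).
  rewrite big1 => [|l /andP[li lj]]; last first.
    by rewrite wE (negbTE li) (negbTE lj) mulr0n mulr0 addr0 mulr0.
  by rewrite /= mulr1n mulr0n; ring.
have ww : dot w w = 1 + k ^+ 2.
  by rewrite dotw !wE !eqxx (negbTE ij) eq_sym (negbTE ij) /= mulr1n mulr0n; ring.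
have w0 : dot w w != 0 by rewrite ww gt_eqF// ltr_pwDl// sqr_ge0.
rewrite /sphere_moment -(uniform_reflection w0 (bdd_sphere_monomial _ _ _ _)).
congr mean; apply/funext => s; rewrite /sphere_fun.
have -> : \1_(esphere R m) (reflection w (X s)) = \1_(esphere R m) (X s) :> R.
  by rewrite !indicE; congr (nat_of_bool _)%:R; apply/idP/idP => /set_mem sx;
    apply/mem_set; move: sx; rewrite /esphere /= enorm_reflection.
have rE (x : 'rV[R]_m) l : reflection w x ord0 l =
    x ord0 l - 2 * (x ord0 i + k * x ord0 j) / (1 + k ^+ 2) * ((l == i)%:R + k * (l == j)%:R).
  by rewrite /reflection -wE -dotw -ww !mxE.
rewrite !rE !eqxx (negbTE ij) [j == i]eq_sym (negbTE ij) /= mulr1n mulr0n.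
by rewrite mulr0 addr0 mulr1 add0r mulr1.
Qed.

Lemma sphere_momentC p q i j : sphere_moment p q i j = sphere_moment q p j i.
Proof.
by congr mean; apply/funext => s; rewrite /sphere_fun; congr (_ * _); rewrite mulrC.
Qed.

(** A sign change of one coordinate turns the moment into its opposite. *)
Lemma sphere_moment_odd p q i j : i != j -> odd p || odd q -> sphere_moment p q i j = 0.
Proof.
wlog op : p q i j / odd p.
  move=> H ij /orP[op|oq]; first by apply: H; rewrite ?op.
  by rewrite sphere_momentC; apply: H => //; rewrite 1?eq_sym// oq.
move=> ij _; suff : sphere_moment p q i j = - sphere_moment p q i j by lra.
rewrite {1}(sphere_moment_reflection 0)//.
have := @mean_sphere_poly unit [:: tt] (fun=> -1) (fun=> p) (fun=> q) (fun=> i) (fun=> j).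
rewrite big_seq1 mulN1r => <-; congr mean; apply/funext => s; rewrite /sphere_fun big_seq1.
congr (_ * _); rewrite mul0r addr0 mulr0 subr0 expr0n/= addr0 divr1.
rewrite (_ : _ - 2 * _ = - (X s : 'rV[R]_m) ord0 i); last by ring.
by rewrite exprNn -signr_odd op expr1 mulN1r mulNr mulN1r.
Qed.

Lemma sphere_moment_swap p q i j : i != j -> sphere_moment p q i j = sphere_moment q p i j.
Proof.
move=> ij; rewrite (sphere_moment_reflection (-1))//; congr mean.
apply/funext => s; rewrite /sphere_fun mulrC [in RHS]mulrC; congr (_ * _).
by rewrite mulrC; congr (_ ^+ _ * _ ^+ _); field.
Qed.

(** With [a] and [b] the two moments, invariance of the fourth power under
    [x_i |-> (3 x_i + 4 x_j) / 5] reads [625 a = 81 a + 864 b + 256 a]: the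
    binomial terms of odd degrees vanish. *)
Lemma sphere_moment40 i j : i != j -> sphere_moment 4 0 i j = 3 * sphere_moment 2 2 i j.
Proof.
move=> ij; have := sphere_moment_reflection (-2) 4 0 ij.
(* The coefficients are those of the expansion of ((3 x + 4 y) / 5) ^ 4. *)
have := @mean_sphere_poly 'I_5 (index_enum _)
  (fun l => [:: 81; 432; 864; 768; 256]`_l / 625) (fun l => nth 0 [:: 4; 3; 2; 1; 0] l)%N
  (fun l => l : nat) (fun=> i) (fun=> j).
rewrite !big_ord_recl big_ord0 /= /bump /= !addn0 !add1n.
rewrite (sphere_moment_odd (p := 3))// (sphere_moment_odd (p := 1))//.
rewrite [sphere_moment 0 4 _ _]sphere_moment_swap//.
set E1 := mean _ _; set E2 := mean _ _; have -> : E1 = E2; last by move=> -> ?; lra.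
congr mean; apply/funext => s; congr (_ * _).
rewrite !big_ord_recl big_ord0 /= /bump /= !addn0 !add1n /=.
by field.
Qed.

Lemma sphere_moment_diag4 i j : sphere_moment 2 2 i i = sphere_moment 4 0 i j.
Proof. by congr mean; apply/funext => s; congr (_ * _); rewrite /= expr0 mulr1 -exprD. Qed.

Lemma sphere_moment0 i j : sphere_moment 0 0 i j = 1.
Proof.
apply/EFin_inj; rewrite -uniform_sphere_as -mean_indic; last first.
  by rewrite -[X in measurable X]setTI; apply: measurable_funP => //; exact: measurable_esphere.
congr (mean _ _)%:E; apply/funext => s; rewrite /sphere_fun !expr0 !mulr1.
by rewrite !indicE; congr (nat_of_bool _)%:R; apply/idP/idP => /set_mem ?; exact/mem_set.
Qed.

(** Identities between polynomials that hold on the sphere pass to the moments. *)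
Lemma mean_sphere_sum_sqr (I : Type) (s : seq I) (p q : I -> nat) (i j : I -> 'I_m) :
  (forall x : 'rV[R]_m, \sum_(k < m) x ord0 k ^+ 2 = 1 ->
    \sum_(l <- s) x ord0 (i l) ^+ p l * x ord0 (j l) ^+ q l = 1) ->
  forall i0 : 'I_m, \sum_(l <- s) sphere_moment (p l) (q l) (i l) (j l) = 1.
Proof.
move=> s1 i0; have := @mean_sphere_poly I s (fun=> 1) p q i j.
under [in RHS]eq_bigr do rewrite mul1r.
move=> <-; rewrite -[RHS](sphere_moment0 i0 i0); congr mean; apply/funext => t.
rewrite /sphere_fun indicE; have [xS|_] := boolP (_ \in _); last by rewrite !mul0r.
rewrite !expr0 mulr1; congr (_ * _); rewrite -[RHS](s1 (X t)).
  by apply: eq_bigr => l _; rewrite mul1r.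
by move: xS; rewrite inE esphereE.
Qed.

(** The [m] second moments are equal by symmetry and add up to [1]. *)
Lemma sphere_moment2 i j : i != j -> sphere_moment 2 0 i j = m%:R^-1.
Proof.
move=> ij; have eq20 k l : sphere_moment 2 0 k l = sphere_moment 2 0 i j.
  have any k' l' l'' : sphere_moment 2 0 k' l' = sphere_moment 2 0 k' l''.
    by congr mean; apply/funext => s; congr (_ * _); rewrite !expr0.
  rewrite (any k l k); have [->|ki] := eqVneq k i; first exact: any.
  by rewrite (any k k i) sphere_moment_swap// sphere_momentC; exact: any.
have := @mean_sphere_sum_sqr 'I_m (index_enum _) (fun=> 2%N) (fun=> 0%N) id id _ i.
under eq_bigr do rewrite eq20.
rewrite sumr_const card_ord -[_ *+ _]mulr_natl => m1.
have m0 : (m%:R : R) != 0.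
  by rewrite pnatr_eq0; apply/eqP => m0; move: (ltn_ord i); rewrite {2}m0.
apply: (mulfI m0); rewrite m1 ?divff// => x <-.
by apply: eq_bigr => k _; rewrite expr0 mulr1.
Qed.

(** Take means in [(\sum_k x_k ^ 2) ^ 2 = 1]: the [m] diagonal terms are equal,
    and each of the [m (m - 1)] others is a third of them. *)
Lemma sphere_moment4 i j : i != j -> sphere_moment 2 2 i i = 3 / (m%:R * (m%:R + 2)).
Proof.
move=> ij; have diag k : sphere_moment 2 2 k k = sphere_moment 2 2 i i.
  have [->//|ki] := eqVneq k i.
  rewrite (sphere_moment_diag4 k i) sphere_moment_swap// sphere_momentC.
  by rewrite -sphere_moment_diag4.
have off k l : k != l -> sphere_moment 2 2 k l = sphere_moment 2 2 i i / 3.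
  by move=> kl; rewrite -(diag k) (sphere_moment_diag4 k l) sphere_moment40//; field.
have := @mean_sphere_sum_sqr ('I_m * 'I_m) (index_enum _) (fun=> 2%N) (fun=> 2%N) fst snd _ i.
rewrite -(pair_bigA _ (fun k l => sphere_moment 2 2 k l)) /=.
have -> : \sum_k \sum_l sphere_moment 2 2 k l =
    m%:R * (sphere_moment 2 2 i i * (1 + (m%:R - 1) / 3)).
  rewrite (eq_bigr (fun=> sphere_moment 2 2 i i * (1 + (m%:R - 1) / 3))).
    by rewrite sumr_const card_ord -[_ *+ _]mulr_natl.
  move=> k _; rewrite (bigD1 k)//= diag mulrDr mulr1; congr (_ + _).
  rewrite (eq_bigr (fun=> sphere_moment 2 2 i i / 3)) => [|l lk]; last by rewrite off// eq_sym.
  rewrite sumr_const -[_ *+ _]mulr_natl cardC1 card_ord.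
  have m_gt0 : (0 < m)%N by apply: leq_ltn_trans (ltn_ord i).
  by rewrite -{2}(prednK m_gt0) -[in RHS]natr1; field.
have m0 : (0 : R) < m%:R by rewrite ltr0n; apply: leq_ltn_trans (ltn_ord i).
move=> H; have {H}e : sphere_moment 2 2 i i * (m%:R * (m%:R + 2) / 3) = 1.
  rewrite -[RHS]H; first by field.
  move=> x x1; rewrite -(pair_bigA _ (fun k l => x ord0 k ^+ 2 * x ord0 l ^+ 2)) /=.
  by under eq_bigr do rewrite -mulr_sumr x1 mulr1.
have m2 : (m%:R * (m%:R + 2) / 3 : R) != 0.
  by rewrite gt_eqF// divr_gt0// mulr_gt0// addr_gt0.
by rewrite -[LHS](mulfK m2) e mul1r invf_div.
Qed.

Lemma sphere_moment22 i j : i != j -> sphere_moment 2 2 i j = (m%:R * (m%:R + 2))^-1.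
Proof.
move=> ij; have := sphere_moment40 ij; rewrite -sphere_moment_diag4 (sphere_moment4 ij) => e.
by lra.
Qed.

End UniformMoments.

(** * Integration along a path and in the mean *)

Section Primitive.
Context {R : realType}.
Implicit Types f g F G : R -> R.

Definition primitive F f := forall x : R, is_derive x 1 F (f x).

Lemma primitive_eq F f g : primitive F f -> f =1 g -> primitive F g.
Proof. by move=> Ff fg x; rewrite -fg; exact: Ff. Qed.

Lemma primitive_cst (k : R) : primitive (fun=> k) (fun=> 0).
Proof. by move=> x; exact: is_derive_cst. Qed.

Lemma primitive_id : primitive (fun x => x) (fun=> 1).
Proof. by move=> x; exact: is_derive_id. Qed.

Lemma primitiveD F G f g : primitive F f -> primitive G g ->
  primitive (fun x => F x + G x) (fun x => f x + g x).
Proof. by move=> Ff Gg x; have ? := Ff x; have ? := Gg x; exact: is_deriveD. Qed.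

Lemma primitiveN F f : primitive F f -> primitive (fun x => - F x) (fun x => - f x).
Proof. by move=> Ff x; have ? := Ff x; exact: is_deriveN. Qed.

Lemma primitiveM F G f g : primitive F f -> primitive G g ->
  primitive (fun x => F x * G x) (fun x => F x * g x + G x * f x).
Proof. by move=> Ff Gg x; have ? := Ff x; have ? := Gg x; exact: is_deriveM. Qed.

Lemma primitiveX n F f : primitive F f ->
  primitive (fun x => F x ^+ n) (fun x => n%:R * F x ^+ n.-1 * f x).
Proof.
move=> Ff x; have ? := Ff x.
rewrite (_ : (fun _ => _) = F ^+ n); first exact: is_deriveX.
by apply/funext => y; rewrite exprfctE.
Qed.

Lemma primitive_expR F f : primitive F f ->
  primitive (fun x => expR (F x)) (fun x => expR (F x) * f x).
Proof.
by move=> Ff x; have ? := Ff x; exact: (@is_derive1_comp _ expR F x).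
Qed.

Lemma primitive_continuous F f : primitive F f -> continuous F.
Proof.
move=> Ff x; apply/differentiable_continuous/derivable1_diffP.
by have [] := Ff x.
Qed.

Lemma integral_primitive F f a b : a <= b -> primitive F f -> continuous f ->
  (\int[lebesgue_measure]_(x in `[a, b]) (f x)%:E = (F b - F a)%:E)%E.
Proof.
rewrite le_eqVlt => /orP[/eqP <- _ _|ab Ff cf].
  by rewrite set_itv1 integral_set1 subrr.
have cF := primitive_continuous Ff.
rewrite (@continuous_FTC2 _ f F)//.
- exact: continuous_subspaceT.
- split; first by move=> x _; have [] := Ff x.
  + by apply: cvg_at_right_filter; exact: cF.
  + by apply: cvg_at_left_filter; exact: cF.
- by move=> x _; rewrite derive1E; have [_ ->] := Ff x.
Qed.

End Primitive.

Ltac primitive_step := first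
  [ apply: primitive_cst | apply: primitive_id | apply: primitiveD
  | apply: primitiveN | apply: primitiveX | apply: primitive_expR
  | apply: primitiveM ].
Ltac primitive_auto := repeat primitive_step.

Section PathIntegral.
Context {R : realType} (tau : nat -> R) (count : R -> nat).
Hypothesis tau0 : tau 0%N = 0.
Hypothesis tau_lt : forall n, tau n < tau n.+1.
Hypothesis count_tau : forall t n, 0 <= t -> (count t = n <-> tau n <= t < tau n.+1).

Lemma count_bounds t : 0 <= t -> tau (count t) <= t < tau (count t).+1.
Proof. by move=> t0; apply/(count_tau _ t0). Qed.

Lemma tau_ge0 n : 0 <= tau n.
Proof. by elim: n => [|n IH]; rewrite ?tau0// (le_trans IH)// ltW. Qed.

Variables (f F : nat -> R -> R).

(** While the counter equals [j] the integrand follows the branch [f j], whose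
    integral is an increment of [F j]; the branches [F j] match at the jump
    times, so the increments telescope to [F (count t) t]. *)
Lemma integral_along_path (t : R) : 0 <= t ->
  (forall j, (j <= count t)%N -> primitive (F j) (f j)) ->
  (forall j, (j <= count t)%N -> continuous (f j)) ->
  (forall j s, (j <= count t)%N -> tau j <= s -> s <= t -> 0 <= f j s) ->
  F 0%N 0 = 0 ->
  (forall j, (j < count t)%N -> F j.+1 (tau j.+1) = F j (tau j.+1)) ->
  (\int[lebesgue_measure]_(s in `[0%R, t]) (f (count s) s)%:E = (F (count t) t)%:E)%E.
Proof.
move=> t0 Ff cf f0 F0 FS; have /andP[tn tn1] := count_bounds t0.
set n := count t in Ff cf f0 FS tn tn1 *.
pose g s := (f (count s) s)%:E.
have gE j s : tau j <= s < tau j.+1 -> g s = (f j s)%:E.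
  move=> js; rewrite /g; have -> // : count s = j.
  by apply/count_tau => //; case/andP: js => + _; apply: le_trans; exact: tau_ge0.
have mf j D : (j <= n)%N -> measurable_fun D (fun s => (f j s)%:E).
  move=> jn; apply/measurable_EFinP/measurable_funTS.
  exact: continuous_measurable_fun (cf _ jn).
have tau_mono i j : (i <= j)%N -> tau i <= tau j.
  by apply: (@homo_leq _ _ (fun x y => x <= y)) => [//|y x z|k]; [exact: le_trans|exact: ltW].
have ftau j : (j <= n)%N -> measurable_fun `[0, tau j[ g /\
    (\int[lebesgue_measure]_(s in `[0%R, tau j[) g s = (F j (tau j))%:E)%E.
  elim: j => [|j IH] jn.
    rewrite tau0 set_itvco0; split; first exact: measurable_fun_set0.
    by rewrite integral_set0 F0.
  have [mj ij] := IH (ltnW jn).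
  have UE : `[0, tau j.+1[%classic = `[0, tau j[ `|` `[tau j, tau j.+1[ :> set R.
    by rewrite -(@itv_bndbnd_setU _ _ _ (BLeft (tau j)))// bnd_simp ?tau_ge0// ltW.
  have mg : measurable_fun `[tau j, tau j.+1[ g.
    apply: (eq_measurable_fun (fun s => (f j s)%:E)); last exact: mf (ltnW jn).
    by move=> s; rewrite inE /= in_itv /= => js; rewrite (gE j).
  have mU : measurable_fun `[0, tau j.+1[ g.
    by rewrite UE; apply/measurable_funU.
  split => //; rewrite UE ge0_integral_setU//; last 3 first.
  - by rewrite -UE.
  - rewrite -UE => s /=; rewrite in_itv /= => /andP[s0 sj].
    have /andP[h1 h2] := count_bounds s0.
    have cj : (count s <= j)%N.
      rewrite leqNgt; apply/negP => /tau_mono; rewrite leNgt => /negP; apply.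
      exact: le_lt_trans sj.
    rewrite lee_fin; apply: f0 => //; first exact: leq_trans cj (ltnW jn).
    by rewrite (le_trans (ltW sj))// (le_trans _ tn)// tau_mono.
  - apply: lt_disjoint => x y; rewrite !in_itv /= => /andP[_ xj] /andP[jy _].
    exact: lt_le_trans jy.
  have -> : (\int[lebesgue_measure]_(s in `[tau j, tau j.+1[) g s =
      \int[lebesgue_measure]_(s in `[tau j, tau j.+1[) (f j s)%:E)%E.
    apply: eq_integral.
    by move=> s; rewrite inE /= in_itv /= => js; rewrite (gE j).
  rewrite ij integral_itv_bndo_bndc; last exact: mf (ltnW jn).
  rewrite (integral_primitive (ltW (tau_lt j)) (Ff _ (ltnW jn)) (cf _ (ltnW jn))).
  by rewrite -EFinD FS// subrKC.
have [mn intn] := ftau n (leqnn n).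
have gn s : s \in `[tau n, t]%classic -> g s = (f n s)%:E.
  rewrite inE /= in_itv /= => /andP[ns st]; apply: gE.
  by rewrite ns (le_lt_trans st).
have UE : `[0, t]%classic = `[0, tau n[ `|` `[tau n, t] :> set R.
  by rewrite -(@itv_bndbnd_setU _ _ _ (BLeft (tau n)))// bnd_simp ?tau_ge0.
rewrite UE ge0_integral_setU//; last 3 first.
- apply/measurable_funU => //; split => //.
  by apply: (eq_measurable_fun (fun s => (f n s)%:E)); [move=> s /gn|exact: mf].
- rewrite -UE => s /=; rewrite in_itv /= => /andP[s0 st].
  have /andP[h1 h2] := count_bounds s0.
  rewrite lee_fin; apply: f0 => //.
  rewrite leqNgt; apply/negP => /tau_mono; rewrite leNgt => /negP; apply.
  exact: le_lt_trans (le_trans h1 st) tn1.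
- apply: lt_disjoint => x y; rewrite !in_itv /= => /andP[_ xj] /andP[jy _].
  exact: lt_le_trans jy.
have -> : (\int[lebesgue_measure]_(s in `[tau n, t]) g s =
    \int[lebesgue_measure]_(s in `[tau n, t]) (f n s)%:E)%E.
  by apply: eq_integral => s /gn.
by rewrite intn (integral_primitive tn (Ff _ (leqnn n)) (cf _ (leqnn n))) -EFinD subrKC.
Qed.

End PathIntegral.

Section MeanTimeIntegral.
Context d (T : measurableType d) (R : realType) (P : probability T R).

(** The device by which all means are computed: if [H] is pathwise a time
    integral of [h], Tonelli's theorem turns its mean into the time integral of
    the means of [h], which is evaluated by a primitive. *)
Lemma mean_time_integral (s M : R) (h : R -> T -> R) (H : T -> R) (g G : R -> R) :
  0 <= s -> measurable_fun (`[0, s] `*` setT) (fun p : R * T => h p.1 p.2) ->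
  (forall u w, 0 <= u <= s -> 0 <= h u w <= M) ->
  (forall w, \int[lebesgue_measure]_(u in `[0%R, s]) (h u w)%:E = (H w)%:E)%E ->
  (forall u, 0 <= u <= s -> mean P (h u) = g u) ->
  primitive G g -> continuous g -> G 0 = 0 ->
  mean P H = G s.
Proof.
move=> s0 mh hM intH meanh Gg cg G0.
have mD : measurable (`[0, s] `*` setT : set (R * T)) by exact: measurableX.
(* The extension by 0 allows Tonelli's theorem on the full product space. *)
pose f (p : R * T) : \bar R := ((fun p : R * T => (h p.1 p.2)%:E) \_ (`[0, s] `*` setT)) p.
have mf : measurable_fun setT f.
  apply: (measurable_restrictT (fun p : R * T => (h p.1 p.2)%:E) mD).1.
  apply/measurable_EFinP; exact: mh.
have f0 p : (0 <= f p)%E.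
  rewrite /f patchE; case: ifPn => //; rewrite inE /= => -[]; rewrite in_itv /= => up _.
  by rewrite lee_fin; case/andP: (hM p.1 p.2 up).
have fE u w : f (u, w) = if u \in `[0, s] then (h u w)%:E else 0%E.
  rewrite /f patchE (_ : ((u, w) \in `[0, s] `*` setT) = (u \in `[0, s]))//.
  by apply/idP/idP => [/set_mem[]//|us]; exact/mem_set.
have bh u : 0 <= u <= s -> bdd_measurable (h u).
  move=> us; split.
    have : measurable_fun setT (fun w => f (u, w)) by exact: measurableT_comp mf (measurable_pair1 u).
    under eq_fun do rewrite fE in_itv /= us.
    by move=> /measurable_EFinP.
  by exists M => w; case/andP: (hM u w us) => ? ?; rewrite ger0_norm.
apply/EFin_inj; rewrite {1}/mean /Rintegral.
suff -> : (\int[P]_w (H w)%:E = (G s)%:E)%E by [].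
under eq_integral do rewrite -intH.
transitivity (\int[P]_w \int[lebesgue_measure]_u f (u, w))%E.
  apply: eq_integral => w _; rewrite [LHS]integral_mkcond; apply: eq_integral => u _.
  by rewrite fE patchE mem_setE.
rewrite -(fubini_tonelli (m1 := lebesgue_measure) (m2 := P))//.
transitivity (\int[lebesgue_measure]_(u in `[0%R, s]) (g u)%:E)%E.
  rewrite [RHS]integral_mkcond; apply: eq_integral => u _.
  rewrite patchE mem_setE; case: ifPn => us.
    rewrite -meanh; last by rewrite in_itv in us.
    rewrite -meanE; last by apply: bh; rewrite in_itv in us.
    by apply: eq_integral => w _; rewrite fE us.
  by apply: integral0_eq => w _; rewrite fE (negbTE us).
by rewrite (integral_primitive s0 Gg cg) G0 subr0.
Qed.

End MeanTimeIntegral.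

(** * Means of functionals of the Poisson path *)

Section PoissonPath.
Context d (T : measurableType d) (R : realType) (P : probability T R).
Variables (lambda : R) (N : R -> {RV P >-> nat}) (tau : nat -> T -> R).
Hypothesis lambda0 : 0 < lambda.
Hypothesis poissonN : poisson_process lambda N.
Hypothesis jumpN : jump_times N tau.

Lemma count_tauP w t n : 0 <= t -> (N t w = n <-> tau n w <= t < tau n.+1 w).
Proof. by move=> t0; exact: jump_times_count jumpN _ _ _ t0. Qed.

Lemma tau_mono w : {homo tau ^~ w : i j / (i <= j)%N >-> i <= j}.
Proof.
apply: homo_leq => [//|y x z|k]; first exact: le_trans.
exact/ltW/(jump_times_increasing jumpN).
Qed.

Lemma tau_countE w t n : 0 <= t -> (tau n w <= t) = (n <= N t w)%N.
Proof.
move=> t0; have /andP[t1 t2] := (count_tauP w _ t0).1 erefl.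
apply/idP/idP => [nt|nN]; last exact: le_trans (tau_mono w nN) t1.
rewrite leqNgt; apply/negP => /(tau_mono w); rewrite leNgt => /negP; apply.
exact: le_lt_trans t2.
Qed.

Lemma jump_time_ge0 w n : 0 <= tau n w.
Proof. by rewrite -(jump_times0 jumpN w); exact: tau_mono. Qed.

Lemma tau_count_le w t : 0 <= t -> tau (N t w) w <= t.
Proof. by move=> t0; rewrite tau_countE. Qed.

(** [<<s path_sets >>] is [sigma_of_process] of the counting process; its generators
    are named to have the type [g_sigma_algebraType path_sets] at hand. *)
Definition path_sets := \bigcup_(t in [set t : R | 0 <= t]) g_sigma_algebra_preimage (N t).

Lemma path_sets_measurable : path_sets `<=` measurable.
Proof.
move=> _ [t _ [A mA <-]]; rewrite setTI -[X in measurable X]setTI.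
exact: measurable_funP.
Qed.

Lemma measurable_count_path t : 0 <= t ->
  measurable_fun setT (N t : g_sigma_algebraType path_sets -> nat).
Proof.
move=> t0 _ A mA; apply: sub_sigma_algebra; exists t => //.
by exists A.
Qed.

Lemma measurable_tau_path n :
  measurable_fun setT (tau n : g_sigma_algebraType path_sets -> R).
Proof.
apply: (measurability _ (RGenOInfty.measurableE R)) => _ [_ [x ->] <-].
rewrite setTI; have [x0|x0] := leP 0 x.
  rewrite (_ : _ @^-1` _ = setT `&` N x @^-1` [set k | (k < n)%N]).
    exact: measurable_count_path.
  by rewrite setTI; apply/funext => w /=; rewrite in_itv /= andbT ltNge tau_countE// -ltnNge.
rewrite (_ : _ @^-1` _ = setT)//; apply/seteqP; split => // w _ /=.
by rewrite in_itv /= andbT (lt_le_trans x0)// jump_time_ge0.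
Qed.

Lemma measurable_tau n : measurable_fun setT (tau n).
Proof.
exact: measurableT_comp (measurable_tau_path n) (measurable_fun_sub_sigma path_sets_measurable).
Qed.

Definition age s w := s - tau (N s w) w.
Definition nojump u s w : R := (N u w == N s w)%:R.
(** Sum of the [p]-th powers of the durations of the segments travelled up to
    time [s], when [n] jumps have occurred by then. *)
Definition duration_powersum_at p n s w : R :=
  \sum_(j < n) (tau j.+1 w - tau j w) ^+ p + (s - tau n w) ^+ p.
Definition duration_powersum p s w := duration_powersum_at p (N s w) s w.

Lemma duration_powersum_at_jump p n w :
  duration_powersum_at p.+1 n.+1 (tau n.+1 w) w = duration_powersum_at p.+1 n (tau n.+1 w) w.
Proof. by rewrite /duration_powersum_at big_ord_recr /= subrr expr0n addr0. Qed.

Lemma duration_powersum_at0 p w : duration_powersum_at p.+1 0 0 w = 0.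
Proof. by rewrite /duration_powersum_at big_ord0 (jump_times0 jumpN) subr0 expr0n addr0. Qed.

Lemma duration_powersum_at_primitive p n w :
  primitive (fun s => duration_powersum_at p.+1 n s w) (fun s => p.+1%:R * (s - tau n w) ^+ p).
Proof.
apply: primitive_eq; first by rewrite /duration_powersum_at; primitive_auto.
by move=> x /=; ring.
Qed.

Lemma duration_powersum_at_ge0 p n s w : tau n w <= s ->
  0 <= duration_powersum_at p n s w.
Proof.
move=> ns; rewrite addr_ge0 ?exprn_ge0 ?subr_ge0// sumr_ge0// => j _.
by rewrite exprn_ge0// subr_ge0; exact: tau_mono.
Qed.

(** Between jumps only the last duration, [age], grows, at unit speed. *)
Lemma age_pow_integral p c w t : 0 <= t -> 0 <= c ->
  (\int[lebesgue_measure]_(s in `[0%R, t]) (c * (p.+1%:R * age s w ^+ p))%:E =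
   (c * duration_powersum p.+1 t w)%:E)%E.
Proof.
move=> t0 c0.
apply: (@integral_along_path _ (tau ^~ w) (fun s => N s w) (jump_times0 jumpN w)
  (fun n => jump_times_increasing jumpN n w) (fun t n => @count_tauP w t n)
  (fun j s => c * (p.+1%:R * (s - tau j w) ^+ p))
  (fun j s => c * duration_powersum_at p.+1 j s w)) => //.
- move=> j _; apply: primitive_eq.
    by apply: primitiveM; [exact: primitive_cst|exact: duration_powersum_at_primitive].
  by move=> x /=; ring.
- by move=> j _; apply: primitive_continuous; primitive_auto.
- by move=> j s _ js _; rewrite !mulr_ge0// exprn_ge0// subr_ge0.
- by rewrite duration_powersum_at0 mulr0.
- by move=> j _; rewrite duration_powersum_at_jump.
Qed.

(** Between jumps the sum of squares has derivative [2 age], so its square has the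
    integrand as derivative. *)
Lemma duration_powersum2_sqr_integral w t : 0 <= t ->
  (\int[lebesgue_measure]_(s in `[0%R, t]) (4 * (age s w * duration_powersum 2 s w))%:E =
   (duration_powersum 2 t w ^+ 2)%:E)%E.
Proof.
move=> t0.
apply: (@integral_along_path _ (tau ^~ w) (fun s => N s w) (jump_times0 jumpN w)
  (fun n => jump_times_increasing jumpN n w) (fun t n => @count_tauP w t n)
  (fun j s => 4 * ((s - tau j w) * duration_powersum_at 2 j s w))
  (fun j s => duration_powersum_at 2 j s w ^+ 2)) => //.
- move=> j _; apply: primitive_eq; first by apply: primitiveX; exact: duration_powersum_at_primitive.
  by move=> x /=; ring.
- by move=> j _; apply: primitive_continuous; rewrite /duration_powersum_at; primitive_auto.
- by move=> j s _ js _; rewrite !mulr_ge0// ?subr_ge0//; exact: duration_powersum_at_ge0.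
- by rewrite duration_powersum_at0 expr0n.
- by move=> j _; rewrite duration_powersum_at_jump.
Qed.

(** The indicator restricts the integral to the last segment before [s]; the
    factor [c] is there to carry a second indicator. *)
Lemma nojump_pow_integral p c w s : 0 <= s -> 0 <= c ->
  (\int[lebesgue_measure]_(u in `[0%R, s])
     (c * (nojump u s w * (p.+1%:R * (s - u) ^+ p)))%:E =
   (c * age s w ^+ p.+1)%:E)%E.
Proof.
move=> s0 c0; set n := N s w.
(* The right-hand side, put in the form of the branch n at time s. *)
rewrite (_ : age s w ^+ p.+1 = (n == n)%:R * ((s - tau n w) ^+ p.+1 - (s - s) ^+ p.+1)); last first.
  by rewrite subrr expr0n subr0 eqxx mul1r.
apply: (@integral_along_path _ (tau ^~ w) (fun s => N s w) (jump_times0 jumpN w)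
  (fun n => jump_times_increasing jumpN n w) (fun t n => @count_tauP w t n)
  (fun j u => c * ((j == n)%:R * (p.+1%:R * (s - u) ^+ p)))
  (fun j u => c * ((j == n)%:R * ((s - tau n w) ^+ p.+1 - (s - u) ^+ p.+1)))) => //.
- move=> j _; apply: primitive_eq; first by primitive_auto.
  by move=> x /=; ring.
- by move=> j _; apply: primitive_continuous; primitive_auto.
- by move=> j u _ js us; rewrite !mulr_ge0// exprn_ge0// subr_ge0.
- case: eqP => [<-|]; last by rewrite mul0r mulr0.
  by rewrite (jump_times0 jumpN) subrr !mulr0.
- move=> j jn; rewrite [in RHS]ltn_eqF// mul0r; case: eqP => [->|]; last by rewrite mul0r.
  by rewrite subrr mulr0.
Qed.

(** The product vanishes at jumps, so it is the integral of its derivative since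
    the last jump. *)
Lemma age_duration_powersum2_integral w s : 0 <= s ->
  (\int[lebesgue_measure]_(u in `[0%R, s])
     (nojump u s w * (duration_powersum 2 u w + 2 * age u w ^+ 2))%:E =
   (age s w * duration_powersum 2 s w)%:E)%E.
Proof.
move=> s0; set n := N s w.
rewrite (_ : age s w * _ = (n == n)%:R * ((s - tau n w) * duration_powersum_at 2 n s w)); last first.
  by rewrite eqxx mul1r.
apply: (@integral_along_path _ (tau ^~ w) (fun s => N s w) (jump_times0 jumpN w)
  (fun n => jump_times_increasing jumpN n w) (fun t n => @count_tauP w t n)
  (fun j u => (j == n)%:R * (duration_powersum_at 2 j u w + 2 * (u - tau j w) ^+ 2))
  (fun j u => (j == n)%:R * ((u - tau j w) * duration_powersum_at 2 j u w))) => //.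
- move=> j _; apply: primitive_eq.
    apply: primitiveM; first exact: primitive_cst.
    by apply: primitiveM; last exact: duration_powersum_at_primitive; primitive_auto.
  by move=> x /=; ring.
- by move=> j _; apply: primitive_continuous; rewrite /duration_powersum_at; primitive_auto.
- move=> j u _ js us; rewrite mulr_ge0// addr_ge0//; first exact: duration_powersum_at_ge0.
  by rewrite mulr_ge0// sqr_ge0.
- by rewrite duration_powersum_at0 !mulr0.
- by move=> j jn; rewrite [in RHS]ltn_eqF// mul0r subrr mul0r mulr0.
Qed.

(** On each of the countably many regions of time and space where the counter is
    constant, the function is one of the [k n]. *)
Lemma measurable_along_path (k : nat -> R -> T -> R) (s : R) :
  (forall n, measurable_fun setT (fun p : R * T => k n p.1 p.2)) ->
  measurable_fun (`[0, s] `*` setT) (fun p : R * T => k (N p.1 p.2) p.1 p.2).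
Proof.
move=> mk.
have mtau n : measurable_fun setT (fun p : R * T => tau n p.2).
  exact: measurableT_comp (measurable_tau n) measurable_snd.
pose A n := (fun p : R * T => p.1) @^-1` `[0, +oo[ `&`
  ((fun p : R * T => p.1 - tau n p.2) @^-1` `[0, +oo[ `&`
   (fun p : R * T => tau n.+1 p.2 - p.1) @^-1` `]0, +oo[).
have mA n : measurable (A n).
  apply: measurableI; last apply: measurableI; rewrite -[X in measurable X]setTI.
  - exact: measurable_fst.
  - by apply: measurable_funB => //; exact: measurable_fst.
  - by apply: measurable_funB => //; exact: measurable_fst.
have AE n p : A n p -> 0 <= p.1 /\ N p.1 p.2 = n.
  rewrite /A /= !in_itv /= !andbT subr_ge0 subr_gt0 => -[p0 [h1 h2]].
  by split => //; apply/(count_tauP _ _ p0); rewrite h1 h2.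
apply: (@measurable_funS _ _ _ _ (\bigcup_n A n)).
- exact: bigcup_measurable.
- move=> p [/= + _]; rewrite in_itv /= => /andP[p0 _].
  exists (N p.1 p.2) => //; have := (count_tauP p.2 _ p0).1 erefl.
  by rewrite /A /= !in_itv /= !andbT subr_ge0 subr_gt0 p0 => /andP[-> ->].
apply/measurable_fun_bigcup => // n.
apply: (eq_measurable_fun (fun p : R * T => k n p.1 p.2)); last exact: measurable_funTS.
by move=> p; rewrite inE => /AE[_ ->].
Qed.

Lemma measurable_at_time (k : nat -> R -> T -> R) (s : R) : 0 <= s ->
  (forall n, measurable_fun setT (fun p : R * T => k n p.1 p.2)) ->
  measurable_fun setT (fun w => k (N s w) s w).
Proof.
move=> s0 mk; apply: (@measurable_comp _ _ _ _ _ _ (`[0, s] `*` setT)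
  (fun p : R * T => k (N p.1 p.2) p.1 p.2) _ (fun w => (s, w))).
- exact: measurableX.
- by move=> _ [w _ <-]; split => //=; rewrite in_itv /= s0 lexx.
- exact: measurable_along_path.
- exact: measurable_pair1.
Qed.

Lemma measurable_elapsed n : measurable_fun setT (fun p : R * T => p.1 - tau n p.2).
Proof.
apply: measurable_funB; first exact: measurable_fst.
exact: measurableT_comp (measurable_tau n) measurable_snd.
Qed.

Lemma measurable_age s : 0 <= s -> measurable_fun setT (age s).
Proof.
by move=> s0; apply: (measurable_at_time s0 (k := fun n s w => s - tau n w)) measurable_elapsed.
Qed.

Lemma measurable_duration_powersum_at p n :
  measurable_fun setT (fun q : R * T => duration_powersum_at p n q.1 q.2).
Proof.
have mtau k : measurable_fun setT (fun p : R * T => tau k p.2).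
  exact: measurableT_comp (measurable_tau k) measurable_snd.
apply: measurable_funD.
  by apply: measurable_sum => j; apply: measurable_funX; exact: measurable_funB.
by apply: measurable_funX; apply: measurable_funB => //; exact: measurable_fst.
Qed.

Lemma measurable_nojump_factor n s :
  measurable_fun setT (fun q : R * T => (n == N s q.2)%:R : R).
Proof.
rewrite (_ : (fun _ => _) = (\1_(N s @^-1` [set n]) : T -> R) \o snd).
  apply: measurableT_comp measurable_snd; apply: measurable_indic.
  by rewrite -[X in measurable X]setTI; exact: measurable_funP.
apply/funext => q /=; rewrite indicE; congr (nat_of_bool _)%:R.
by apply/eqP/idP => [->|/set_mem <-//]; exact/mem_set.
Qed.

(** A duration is at most [s], so its power is at most [s ^ p] times itself, and
    the durations add up to [s]. *)
Lemma duration_powersum_at_le p n s w : tau n w <= s ->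
  duration_powersum_at p.+1 n s w <= s ^+ p.+1.
Proof.
move=> ns; have s0 : 0 <= s by exact: le_trans (jump_time_ge0 w n) ns.
have gap x y : 0 <= x -> x <= y -> y <= s -> (y - x) ^+ p.+1 <= s ^+ p * (y - x).
  move=> x0 xy ys; rewrite exprSr ler_wpM2r ?subr_ge0// lerXn2r ?nnegrE ?subr_ge0//.
  by rewrite (le_trans _ ys)// gerBl.
have sumgap k : (k <= n)%N ->
    \sum_(j < k) (tau j.+1 w - tau j w) ^+ p.+1 <= s ^+ p * tau k w.
  elim: k => [|k IH] kn; first by rewrite big_ord0 (jump_times0 jumpN) mulr0.
  rewrite big_ord_recr /= -[X in s ^+ p * X](subrKC (tau k w)) mulrDr lerD//.
    exact: IH (ltnW kn).
  apply: gap; [exact: jump_time_ge0|exact: tau_mono|].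
  by rewrite (le_trans _ ns)//; exact: tau_mono.
rewrite exprSr -[X in s ^+ p * X](subrKC (tau n w)) mulrDr lerD//; first exact: sumgap.
by apply: gap => //; exact: jump_time_ge0.
Qed.

Lemma duration_powersum_bounds p s w : 0 <= s ->
  0 <= duration_powersum p.+1 s w <= s ^+ p.+1.
Proof.
by move=> s0; rewrite duration_powersum_at_ge0 ?duration_powersum_at_le//; exact: tau_count_le.
Qed.

Lemma age_bounds s w : 0 <= s -> 0 <= age s w <= s.
Proof.
by move=> s0; rewrite subr_ge0 tau_count_le// gerBl; exact: jump_time_ge0.
Qed.

Lemma nojump_bounds u s w : 0 <= nojump u s w <= 1.
Proof. by rewrite /nojump ler0n lern1 leq_b1. Qed.

(** Probability of no jump during a time [x]. *)
Definition survival x := expR (- (lambda * x)).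

Lemma survival0 : survival 0 = 1.
Proof. by rewrite /survival mulr0 oppr0 expR0. Qed.

Lemma nojump_indic u s : 0 <= u <= s -> nojump u s = \1_[set w | (N s w - N u w)%N = 0%N].
Proof.
move=> /andP[u0 us]; apply/funext => w; rewrite /nojump indicE; congr (nat_of_bool _)%:R.
have Nus := poisson_process_nondecreasing poissonN w u0 us.
apply/eqP/idP => [us'|/set_mem /= /eqP]; first by apply/mem_set; rewrite /= us' subnn.
by rewrite subn_eq0 => sN; apply/eqP; rewrite eqn_leq Nus.
Qed.

Lemma measurable_increment u s k : measurable [set w | (N s w - N u w)%N = k].
Proof.
rewrite (_ : [set _ | _] = \bigcup_n (N u @^-1` [set n] `&` N s @^-1` [set j | (j - n)%N = k])).
  apply: bigcup_measurable => n _; apply: measurableI.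
  - by rewrite -[X in measurable X]setTI; exact: measurable_funP.
  - by rewrite -[X in measurable X]setTI; exact: measurable_funP.
apply/seteqP; split => w /=; first by move=> nk; exists (N u w).
by move=> [n _ [<-]].
Qed.

Lemma mean_nojump u s : 0 <= u <= s -> mean P (nojump u s) = survival (s - u).
Proof.
move=> us; rewrite nojump_indic//; apply/EFin_inj; rewrite mean_indic//; last exact: measurable_increment.
case/andP: us => u0; rewrite le_eqVlt => /orP[/eqP <-|us].
  rewrite subrr /survival mulr0 oppr0 expR0 (_ : [set _ | _] = setT) ?probability_setT//.
  by apply/seteqP; split => // w _ /=; rewrite subnn.
rewrite (poisson_process_law poissonN 0%N u0 us) /poisson_pmf.
by rewrite mulr_gt0 ?subr_gt0// expr0 fact0 invr1 !mul1r.
Qed.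

(** Increments over disjoint intervals are independent: the sequence of times is
    [x], [v], [u], [s], [s], and so on, and increments [0] and [2] are used. *)
Lemma mean_nojump2 x v u s : 0 <= x <= v -> v <= u <= s ->
  mean P (fun w => nojump u s w * nojump x v w) = survival (s - u) * survival (v - x).
Proof.
move=> xv vus; have [x0 xv'] := andP xv; have [vu us] := andP vus.
have v0 := le_trans x0 xv'; have u0 := le_trans v0 vu.
rewrite -!mean_nojump ?u0 ?us//.
rewrite !nojump_indic ?u0 ?us//.
apply/EFin_inj; rewrite mean_indicM ?EFinM ?mean_indic; [|exact: measurable_increment..].
pose t i := match i with 0 => x | 1 => v | 2 => u | _ => s end%N.
have t_homo : {homo t : i j / (i <= j)%N >-> i <= j}.
  apply: homo_leq => [//|y z k|]; first exact: le_trans.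
  by move=> [|[|[|n]]] /=.
have := poisson_process_increments poissonN x0 t_homo.
move=> /(_ (2%N |` [fset 0%N])%fset (fun i => [set w | (N (t i.+1) w - N (t i) w)%N = 0%N])).
have -> : \bigcap_(i in [set` (2%N |` [fset 0%N])%fset])
    [set w | (N (t i.+1) w - N (t i) w)%N = 0%N] =
    [set w | (N s w - N u w)%N = 0%N] `&` [set w | (N v w - N x w)%N = 0%N].
  apply/seteqP; split => w /=.
    by move=> H; split; [apply: (H 2%N)|apply: (H 0%N)]; rewrite /= !inE.
  by move=> [h1 h2] i /=; rewrite !inE => /orP[] /eqP ->.
rewrite big_fsetU1 ?inE//= big_seq_fset1 => -> // i _.
by exists [set 0%N] => //; rewrite setTI.
Qed.

Lemma measurable_nojump u s : 0 <= u <= s -> measurable_fun setT (nojump u s).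
Proof.
by move=> us; rewrite nojump_indic//; apply: measurable_indic; exact: measurable_increment.
Qed.

Let lambda_neq0 : lambda != 0. Proof. by rewrite gt_eqF. Qed.

(** The age is the integral of no-jump indicators; integrate the probability that
    both intervals are free of jumps over the left end of the earlier one. *)
Lemma mean_nojump_age v u s : 0 <= v <= u -> u <= s ->
  mean P (fun w => nojump u s w * age v w) = survival (s - u) * ((1 - survival v) / lambda).
Proof.
move=> /andP[v0 vu] us.
have us' : 0 <= u <= s by rewrite us (le_trans v0).
pose g x := survival (s - u) * survival (v - x).
pose G x := survival (s - u) * ((survival (v - x) - survival v) / lambda).
have -> : survival (s - u) * ((1 - survival v) / lambda) = G v.
  by rewrite /G subrr survival0.
apply: (@mean_time_integral _ _ _ P v 1
  (fun x w => nojump u s w * (nojump x v w * (1%:R * (v - x) ^+ 0))) _ g) => //.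
- apply: (@measurable_along_path
    (fun n x w => nojump u s w * ((n == N v w)%:R * (1%:R * (v - x) ^+ 0)))) => n.
  apply: measurable_funM.
    exact: measurableT_comp (measurable_nojump us') measurable_snd.
  apply: measurable_funM; first exact: measurable_nojump_factor.
  by under eq_fun do rewrite expr0 mulr1; exact: measurable_cst.
- move=> x w /andP[x0 xv]; rewrite expr0 !mulr1.
  have /andP[a0 a1] := nojump_bounds u s w; have /andP[b0 b1] := nojump_bounds x v w.
  by rewrite mulr_ge0//= mulr_ile1.
- by move=> w; rewrite nojump_pow_integral.
- move=> x /andP[x0 xv]; rewrite /g -mean_nojump2 ?x0 ?vu//.
  by congr mean; apply/funext => w; rewrite expr0 !mulr1.
- rewrite /G /survival; apply: primitive_eq; first by primitive_auto.
  by move=> x /=; rewrite /g /survival; field.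
- by rewrite /g /survival; apply: primitive_continuous; primitive_auto.
- by rewrite /G subr0 subrr mul0r mulr0.
Qed.

Lemma mean_nojump_age2 u s : 0 <= u <= s ->
  mean P (fun w => nojump u s w * age u w ^+ 2) =
  survival (s - u) * (2 / lambda ^+ 2 * (1 - survival u * (1 + lambda * u))).
Proof.
move=> us'; have [u0 us] := andP us'.
pose g x := survival (s - u) * survival (u - x) * (2 * (u - x)).
pose G x := survival (s - u) * (2 / lambda ^+ 2 *
  (survival (u - x) * (1 + lambda * (u - x)) - survival u * (1 + lambda * u))).
have -> : survival (s - u) * (2 / lambda ^+ 2 * (1 - survival u * (1 + lambda * u))) = G u.
  by rewrite /G subrr survival0 mulr0 addr0 mulr1.
apply: (@mean_time_integral _ _ _ P u (2 * u)
  (fun x w => nojump u s w * (nojump x u w * (2%:R * (u - x) ^+ 1))) _ g) => //.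
- apply: (@measurable_along_path
    (fun n x w => nojump u s w * ((n == N u w)%:R * (2%:R * (u - x) ^+ 1)))) => n.
  apply: measurable_funM.
    exact: measurableT_comp (measurable_nojump us') measurable_snd.
  apply: measurable_funM; first exact: measurable_nojump_factor.
  apply: measurable_funM => //; apply: measurable_funX.
  by apply: measurable_funB => //; exact: measurable_fst.
- move=> x w /andP[x0 xu]; rewrite expr1.
  have /andP[a0 a1] := nojump_bounds u s w; have /andP[b0 b1] := nojump_bounds x u w.
  rewrite !mulr_ge0 ?subr_ge0//= mulrA -[leRHS]mul1r ler_pM ?mulr_ge0 ?mulr_ile1 ?subr_ge0//.
  by rewrite ler_wpM2l// gerBl.
- by move=> w; rewrite nojump_pow_integral.
- move=> x /andP[x0 xu]; rewrite /g -mean_nojump2 ?x0 ?us ?lexx//.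
  rewrite [RHS]mulrC -meanZ; last first.
    split; first by apply: measurable_funM; apply: measurable_nojump; rewrite ?x0.
    exists 1 => w; rewrite normrM mulr_ile1//; (have /andP[a0 a1] := nojump_bounds u s w);
      have /andP[b0 b1] := nojump_bounds x u w; by rewrite ger0_norm.
  by congr mean; apply/funext => w; rewrite expr1; ring.
- rewrite /G /survival; apply: primitive_eq; first by primitive_auto.
  by move=> x /=; rewrite /g /survival; field.
- by rewrite /g /survival; apply: primitive_continuous; primitive_auto.
- by rewrite /G subr0 subrr !mulr0.
Qed.

(** The sum of squares is the integral of [2 age]. *)
Lemma mean_nojump_duration_powersum2 u s : 0 <= u <= s ->
  mean P (fun w => nojump u s w * duration_powersum 2 u w) =
  survival (s - u) * (2 * (u / lambda - (1 - survival u) / lambda ^+ 2)).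
Proof.
move=> us'; have [u0 us] := andP us'.
pose g v := 2 * (survival (s - u) * ((1 - survival v) / lambda)).
pose G v := survival (s - u) * (2 * (v / lambda - (1 - survival v) / lambda ^+ 2)).
apply: (@mean_time_integral _ _ _ P u (2 * u)
  (fun v w => nojump u s w * (2%:R * age v w ^+ 1)) _ g G) => //.
- apply: (@measurable_along_path
    (fun n v w => nojump u s w * (2%:R * (v - tau n w) ^+ 1))) => n.
  apply: measurable_funM.
    exact: measurableT_comp (measurable_nojump us') measurable_snd.
  apply: measurable_funM => //; apply: measurable_funX.
  exact: measurable_elapsed.
- move=> v w /andP[v0 vu]; rewrite expr1.
  have /andP[a0 a1] := nojump_bounds u s w; have /andP[b0 b1] := age_bounds w v0.
  rewrite !mulr_ge0//= -[leRHS]mul1r ler_pM ?mulr_ge0//.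
  by rewrite ler_wpM2l// (le_trans b1).
- by move=> w; rewrite age_pow_integral.
- move=> v /andP[v0 vu]; rewrite /g -mean_nojump_age ?v0//.
  rewrite -meanZ; last first.
    split.
      apply: measurable_funM; first exact: measurable_nojump.
      exact: measurable_age.
    exists u => w; rewrite normrM -[leRHS]mul1r ler_pM//.
      by have /andP[a0 a1] := nojump_bounds u s w; rewrite ger0_norm.
    by have /andP[b0 b1] := age_bounds w v0; rewrite ger0_norm// (le_trans b1).
  by congr mean; apply/funext => w; rewrite expr1; ring.
- rewrite /G /survival; apply: primitive_eq; first by primitive_auto.
  by move=> x /=; rewrite /g /survival; field.
- by rewrite /g /survival; apply: primitive_continuous; primitive_auto.
- by rewrite /G survival0 subrr !mul0r subrr !mulr0.
Qed.

Lemma measurable_duration_powersum p s : 0 <= s ->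
  measurable_fun setT (duration_powersum p s).
Proof.
move=> s0; apply: (measurable_at_time s0 (k := duration_powersum_at p)) => n.
exact: measurable_duration_powersum_at.
Qed.

Lemma bdd_nojump_age2 u s : 0 <= u <= s ->
  bdd_measurable (fun w => nojump u s w * age u w ^+ 2).
Proof.
move=> us; have [u0 _] := andP us; split.
  by apply: measurable_funM; [exact: measurable_nojump|apply: measurable_funX; exact: measurable_age].
exists (u ^+ 2) => w; have /andP[a0 a1] := nojump_bounds u s w.
have /andP[b0 b1] := age_bounds w u0.
by rewrite ger0_norm ?mulr_ge0 ?sqr_ge0// -[leRHS]mul1r ler_pM ?sqr_ge0// lerXn2r.
Qed.

(** The square terms of the integrand come from the two previous computations; the
    exponentials combine by the semigroup property of [survival]. *)
Lemma mean_age_duration_powersum2 s : 0 <= s ->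
  mean P (fun w => age s w * duration_powersum 2 s w) =
  2 * s / lambda ^+ 2 - survival s * (2 * s / lambda ^+ 2 + 2 * s ^+ 2 / lambda).
Proof.
move=> s0.
pose g u := survival (s - u) * (2 * u / lambda + 2 / lambda ^+ 2)
  - survival s * (2 / lambda ^+ 2 + 4 * u / lambda).
pose G u := survival (s - u) * (2 * u / lambda ^+ 2)
  - survival s * (2 * u / lambda ^+ 2 + 2 * u ^+ 2 / lambda).
have -> : 2 * s / lambda ^+ 2 - survival s * (2 * s / lambda ^+ 2 + 2 * s ^+ 2 / lambda) = G s.
  by rewrite /G subrr survival0 mul1r.
apply: (@mean_time_integral _ _ _ P s (s ^+ 2 + 2 * s ^+ 2)
  (fun u w => nojump u s w * (duration_powersum 2 u w + 2 * age u w ^+ 2)) _ g G) => //.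
- apply: (@measurable_along_path
    (fun n u w =>
    (n == N s w)%:R * (duration_powersum_at 2 n u w + 2 * (u - tau n w) ^+ 2))) => n.
  apply: measurable_funM; first exact: measurable_nojump_factor.
  apply: measurable_funD; first exact: measurable_duration_powersum_at.
  by apply: measurable_funM => //; apply: measurable_funX; exact: measurable_elapsed.
- move=> u w /andP[u0 us].
  have /andP[a0 a1] := nojump_bounds u s w; have /andP[b0 b1] := age_bounds w u0.
  have /andP[c0 c1] := duration_powersum_bounds 1 w u0.
  have us2 : u ^+ 2 <= s ^+ 2 by rewrite lerXn2r.
  have a2 : age u w ^+ 2 <= s ^+ 2 by rewrite lerXn2r ?nnegrE// (le_trans b0 b1, le_trans b1 us).
  have e0 : 0 <= duration_powersum 2 u w + 2 * age u w ^+ 2 by rewrite addr_ge0// mulr_ge0// sqr_ge0.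
  rewrite mulr_ge0//= -[leRHS]mul1r ler_pM// lerD//; first exact: le_trans c1 us2.
  by rewrite ler_wpM2l.
- by move=> w; exact: age_duration_powersum2_integral.
- move=> u /andP[u0 us]; have us' : 0 <= u <= s by rewrite u0.
  transitivity (mean P (fun w => nojump u s w * duration_powersum 2 u w)
     + 2 * mean P (fun w => nojump u s w * age u w ^+ 2)).
    rewrite -meanZ -?meanD.
    - by congr mean; apply/funext => w; ring.
    - split.
        apply: measurable_funM; first exact: measurable_nojump.
        exact: measurable_duration_powersum.
      exists (u ^+ 2) => w; have /andP[a0 a1] := nojump_bounds u s w.
      have /andP[c0 c1] := duration_powersum_bounds 1 w u0.
      by rewrite ger0_norm ?mulr_ge0// -[leRHS]mul1r ler_pM.
    - apply: bddM; first exact: bdd_cst.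
      exact: bdd_nojump_age2.
    - exact: bdd_nojump_age2.
  rewrite mean_nojump_duration_powersum2// mean_nojump_age2// /g.
  have -> : survival s = survival (s - u) * survival u.
    by rewrite /survival -expRD; congr expR; ring.
  by field.
- rewrite /G /survival; apply: primitive_eq; first by primitive_auto.
  by move=> x /=; rewrite /g /survival; field.
- by rewrite /g /survival; apply: primitive_continuous; primitive_auto.
- by rewrite /G expr0n /= !mulr0 !mul0r addr0 !mulr0 subrr.
Qed.

Lemma mean_age3 s : 0 <= s ->
  mean P (fun w => age s w ^+ 3) =
  6 / lambda ^+ 3 * (1 - survival s * (1 + lambda * s + lambda ^+ 2 * s ^+ 2 / 2)).
Proof.
move=> s0.
pose E y := survival y * (1 + lambda * y + lambda ^+ 2 * y ^+ 2 / 2).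
pose g u := survival (s - u) * (3 * (s - u) ^+ 2).
pose G u := 6 / lambda ^+ 3 * (E (s - u) - E s).
have -> : 6 / lambda ^+ 3 * (1 - E s) = G s.
  by rewrite /G /E subrr survival0 !mulr0 expr0n /= !mulr0 mul0r !addr0 mulr1.
apply: (@mean_time_integral _ _ _ P s (3 * s ^+ 2)
  (fun u w => 1 * (nojump u s w * (3%:R * (s - u) ^+ 2))) _ g G) => //.
- apply: (@measurable_along_path
    (fun n u w => 1 * ((n == N s w)%:R * (3%:R * (s - u) ^+ 2)))) => n.
  apply: measurable_funM => //; apply: measurable_funM; first exact: measurable_nojump_factor.
  apply: measurable_funM => //; apply: measurable_funX.
  by apply: measurable_funB => //; exact: measurable_fst.
- move=> u w /andP[u0 us]; have /andP[a0 a1] := nojump_bounds u s w.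
  rewrite mul1r !mulr_ge0 ?exprn_ge0 ?subr_ge0//= -[leRHS]mul1r ler_pM ?mulr_ge0 ?exprn_ge0 ?subr_ge0//.
  by rewrite ler_wpM2l// lerXn2r ?nnegrE ?subr_ge0// gerBl.
- by move=> w; rewrite nojump_pow_integral// mul1r.
- move=> u us; rewrite /g -mean_nojump// [RHS]mulrC -meanZ; last first.
    split; first exact: measurable_nojump.
    by exists 1 => w; have /andP[a0 a1] := nojump_bounds u s w; rewrite ger0_norm.
  by congr mean; apply/funext => w; ring.
- rewrite /G /E /survival; apply: primitive_eq; first by primitive_auto.
  by move=> x /=; rewrite /g /survival; field.
- by rewrite /g /survival; apply: primitive_continuous; primitive_auto.
- by rewrite /G subr0 subrr mulr0.
Qed.

Lemma mean_duration_powersum2_sqr t : 0 <= t ->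
  mean P (fun w => duration_powersum 2 t w ^+ 2) =
  4 * t ^+ 2 / lambda ^+ 2 - 24 / lambda ^+ 4
  + survival t * (8 * t ^+ 2 / lambda ^+ 2 + 24 * t / lambda ^+ 3 + 24 / lambda ^+ 4).
Proof.
move=> t0.
pose g s := 4 * (2 * s / lambda ^+ 2 - survival s * (2 * s / lambda ^+ 2 + 2 * s ^+ 2 / lambda)).
pose G s := 4 * s ^+ 2 / lambda ^+ 2 - 24 / lambda ^+ 4
  + survival s * (8 * s ^+ 2 / lambda ^+ 2 + 24 * s / lambda ^+ 3 + 24 / lambda ^+ 4).
apply: (@mean_time_integral _ _ _ P t (4 * (t * t ^+ 2))
  (fun s w => 4 * (age s w * duration_powersum 2 s w)) _ g G) => //.
- apply: (@measurable_along_path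
    (fun n s w => 4 * ((s - tau n w) * duration_powersum_at 2 n s w))) => n.
  apply: measurable_funM => //; apply: measurable_funM; first exact: measurable_elapsed.
  exact: measurable_duration_powersum_at.
- move=> s w /andP[s0 st]; have /andP[b0 b1] := age_bounds w s0.
  have /andP[c0 c1] := duration_powersum_bounds 1 w s0.
  rewrite !mulr_ge0//= ler_wpM2l// ler_pM// ?(le_trans b1)// (le_trans c1)//.
  by rewrite lerXn2r.
- by move=> w; exact: duration_powersum2_sqr_integral.
- move=> s /andP[s0 st]; rewrite /g -mean_age_duration_powersum2// -meanZ//.
  split.
    by apply: measurable_funM; [exact: measurable_age|exact: measurable_duration_powersum].
  exists (s * s ^+ 2) => w; have /andP[b0 b1] := age_bounds w s0.
  have /andP[c0 c1] := duration_powersum_bounds 1 w s0.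
  by rewrite ger0_norm ?mulr_ge0// ler_pM.
- rewrite /G /survival; apply: primitive_eq; first by primitive_auto.
  by move=> x /=; rewrite /g /survival; field.
- by rewrite /g /survival; apply: primitive_continuous; primitive_auto.
- by rewrite /G expr0n survival0 /= !mulr0 !mul0r; ring.
Qed.

Lemma mean_duration_powersum4 t : 0 <= t ->
  mean P (duration_powersum 4 t) =
  24 / lambda ^+ 3 * (t - 3 / lambda
    + survival t * (lambda * t ^+ 2 / 2 + 2 * t + 3 / lambda)).
Proof.
move=> t0.
pose g s := 4 * (6 / lambda ^+ 3 * (1 - survival s * (1 + lambda * s + lambda ^+ 2 * s ^+ 2 / 2))).
pose G s := 24 / lambda ^+ 3 * (s - 3 / lambda
    + survival s * (lambda * s ^+ 2 / 2 + 2 * s + 3 / lambda)).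
apply: (@mean_time_integral _ _ _ P t (4 * t ^+ 3)
  (fun s w => 1 * (4%:R * age s w ^+ 3)) _ g G) => //.
- apply: (@measurable_along_path
    (fun n s w => 1 * (4%:R * (s - tau n w) ^+ 3))) => n.
  apply: measurable_funM => //; apply: measurable_funM => //; apply: measurable_funX.
  exact: measurable_elapsed.
- move=> s w /andP[s0 st]; have /andP[b0 b1] := age_bounds w s0.
  rewrite mul1r mulr_ge0 ?exprn_ge0//= ler_wpM2l// lerXn2r// (le_trans b1)//.
- by move=> w; rewrite age_pow_integral// mul1r.
- move=> s /andP[s0 st]; rewrite /g -mean_age3// -meanZ//.
    by congr mean; apply/funext => w; rewrite mul1r.
  split; first by apply: measurable_funX; exact: measurable_age.
  exists (s ^+ 3) => w; have /andP[b0 b1] := age_bounds w s0.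
  by rewrite ger0_norm ?exprn_ge0// lerXn2r.
- rewrite /G /survival; apply: primitive_eq; first by primitive_auto.
  by move=> x /=; rewrite /g /survival; field.
- by rewrite /g /survival; apply: primitive_continuous; primitive_auto.
- by rewrite /G expr0n survival0 /= !mulr0 !mul0r; ring.
Qed.

End PoissonPath.

(** * The fourth-order moment of the flight *)

Section QuadrupleSums.
Context {R : comRingType} {I : finType}.

Lemma sqr_sum_mul (x y : I -> R) :
  (\sum_i x i) ^+ 2 * (\sum_i y i) ^+ 2 =
  \sum_(q : (I * I) * (I * I)) x q.1.1 * x q.1.2 * (y q.2.1 * y q.2.2).
Proof.
have sq (z : I -> R) : (\sum_i z i) ^+ 2 = \sum_(p : I * I) z p.1 * z p.2.
  by rewrite expr2 big_distrlr /= pair_bigA.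
by rewrite !sq big_distrlr /= pair_bigA.
Qed.

Lemma sum_pairE (J K : finType) (F : J * K -> R) : \sum_q F q = \sum_a \sum_b F (a, b).
Proof. by rewrite pair_bigA; apply: eq_bigr => -[]. Qed.

(** Only the quadruples made of two equal pairs contribute. *)
Lemma sum_paired (F : (I * I) * (I * I) -> R) :
  (forall q, (q.1.1 != q.1.2) || (q.2.1 != q.2.2) -> F q = 0) ->
  \sum_q F q = \sum_a \sum_b F ((a, a), (b, b)).
Proof.
move=> F0; rewrite sum_pairE sum_pairE.
apply: eq_bigr => a _; rewrite (bigD1 a)//= [X in _ + X]big1 ?addr0; last first.
  by move=> a' aa'; rewrite big1// => p2 _; rewrite F0//= eq_sym aa'.
rewrite sum_pairE.
apply: eq_bigr => b _; rewrite (bigD1 b)//= [X in _ + X]big1 ?addr0// => b' bb'.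
by rewrite F0//= [b == b']eq_sym bb' orbT.
Qed.

End QuadrupleSums.

Section Flight.
Context d (T : measurableType d) (R : realType) (P : probability T R).
Variables (m : nat) (c lambda : R) (N : R -> {RV P >-> nat}) (tau : nat -> T -> R).
Variable U : nat -> {RV P >-> borel_rV R m}.
Hypothesis lambda0 : 0 < lambda.
Hypothesis flight : random_flight lambda N tau U.
Variables (i0 i1 : 'I_m).
Hypothesis i01 : i0 != i1.
Variable (t : R).
Hypothesis t0 : 0 <= t.

Let poissonN := random_flight_poisson flight.
Let jumpN := random_flight_jumps flight.
Let unifU j := random_flight_uniform flight j.

(** The analogue of [path_sets] for the directions. *)
Definition direction_sets := \bigcup_(j in [set: nat]) g_sigma_algebra_preimage (U j).

Lemma direction_sets_measurable : direction_sets `<=` measurable.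
Proof.
move=> _ [j _ [A mA <-]]; rewrite setTI -[X in measurable X]setTI.
exact: measurable_funP.
Qed.

Lemma measurable_direction j :
  measurable_fun setT (U j : g_sigma_algebraType direction_sets -> borel_rV R m).
Proof.
move=> _ A mA; apply: sub_sigma_algebra; exists j => //.
by exists A.
Qed.

(** Duration of segment [j] of the path on the event that [n] jumps occur by time
    [t], and [0] off this event; this makes it bounded, and measurable for the
    sigma-algebra of the counting process. *)
Definition leg n j w : R :=
  (N t w == n)%:R * ((if (j < n)%N then tau j.+1 w else t) - tau j w).

Lemma bdd_leg n j : (j <= n)%N ->
  bdd_measurable (leg n j : g_sigma_algebraType (path_sets N) -> R).
Proof.
move=> jn; split.
  apply: measurable_funM.
    rewrite (_ : (fun _ => _) = \1_(N t @^-1` [set n])).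
      apply: measurable_indic; rewrite -[X in measurable X]setTI.
      exact: measurable_count_path.
    apply/funext => w /=; rewrite indicE; congr (nat_of_bool _)%:R.
    by apply/eqP/idP => [?|/set_mem//]; exact/mem_set.
  apply: measurable_funB; last exact: (measurable_tau_path jumpN).
  by case: (j < n)%N => //; exact: (measurable_tau_path jumpN).
exists t => w; rewrite /leg; case: eqP => [Nn|_]; last by rewrite mul0r normr0.
have tj k : (k <= n)%N -> tau k w <= t by move=> kn; rewrite (tau_countE jumpN)// Nn.
rewrite mul1r; case: ifP => [jn'|_]; rewrite ger0_norm ?subr_ge0//.
- by rewrite (le_trans _ (tj _ jn'))// gerBl (jump_time_ge0 jumpN).
- exact: (tau_mono jumpN).
- by rewrite gerBl (jump_time_ge0 jumpN).
- exact: tj.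
Qed.

Lemma bdd_leg_ambient n j : (j <= n)%N -> bdd_measurable (leg n j).
Proof.
move=> jn; apply: (bdd_comp _ (bdd_leg jn)).
exact: measurable_fun_sub_sigma (@path_sets_measurable _ _ _ _ N).
Qed.

Lemma flight_position_legs n k w : N t w = n ->
  flight_position c N tau U t w ord0 k =
  c * \sum_(j < n.+1) leg n j w * (U j w : 'rV[R]_m) ord0 k.
Proof.
move=> Nn; rewrite /flight_position Nn !mxE summxE big_mkord big_ord_recr /= [RHS]mulrDr.
congr (_ * _ + _).
  by apply: eq_bigr => j _; rewrite mxE /leg Nn eqxx mul1r ltn_ord.
by rewrite /leg Nn eqxx mul1r ltnn mulrA.
Qed.

Lemma sum_leg_pow p n w : N t w = n ->
  \sum_(j < n.+1) leg n j w ^+ p = duration_powersum N tau p t w.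
Proof.
move=> Nn; rewrite /duration_powersum Nn /duration_powersum_at big_ord_recr /=; congr (_ + _).
  by apply: eq_bigr => j _; rewrite /leg Nn eqxx mul1r ltn_ord.
by rewrite /leg Nn eqxx mul1r ltnn.
Qed.

(** The product of four coordinates of directions, grouped by direction so that
    the product rule for independent directions applies. *)
Definition directions n (q : ('I_n.+1 * 'I_n.+1) * ('I_n.+1 * 'I_n.+1)) w : R :=
  \prod_(j < n.+1) sphere_fun (fun x : 'rV[R]_m =>
     x ord0 i0 ^+ ((q.1.1 == j) + (q.1.2 == j)) *
     x ord0 i1 ^+ ((q.2.1 == j) + (q.2.2 == j))) (U j w).

Lemma directionsE n q w : (forall j, esphere R m (U j w)) ->
  directions q w = (U q.1.1 w : 'rV[R]_m) ord0 i0 * (U q.1.2 w : 'rV[R]_m) ord0 i0 *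
   ((U q.2.1 w : 'rV[R]_m) ord0 i1 * (U (q.2.2 : 'I_n.+1) w : 'rV[R]_m) ord0 i1).
Proof.
move=> US; rewrite /directions.
under eq_bigr do rewrite /sphere_fun indicE mem_set// mul1r !exprD.
have pick (x : 'I_n.+1 -> R) (a : 'I_n.+1) : \prod_(j < n.+1) x j ^+ (a == j) = x a.
  rewrite (bigD1 a)//= eqxx expr1 big1 ?mulr1// => j ja.
  by rewrite eq_sym (negbTE ja) expr0.
rewrite !big_split /= !pick//.
Qed.

Lemma mean_directions n q : mean P (@directions n q) =
  \prod_(j < n.+1) sphere_moment (U j)
     ((q.1.1 == j) + (q.1.2 == j)) ((q.2.1 == j) + (q.2.2 == j)) i0 i1.
Proof.
pose f (j : nat) := sphere_fun (fun x : 'rV[R]_m =>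
     x ord0 i0 ^+ ((q.1.1 == j :> nat) + (q.1.2 == j :> nat)) *
     x ord0 i1 ^+ ((q.2.1 == j :> nat) + (q.2.2 == j :> nat))).
rewrite -[LHS]/(mean P (fun w => \prod_(j < n.+1) f j (U j w))).
have mU j : measurable_fun setT (U j) by exact: measurable_funP.
have bf j : bdd_measurable (f j) by exact: bdd_sphere_monomial.
exact: (mean_prod_independent mU (random_flight_directions flight) n.+1 bf).
Qed.

(** Some direction enters with an odd power of one of its coordinates. *)
Lemma mean_directions_unpaired n (q : ('I_n.+1 * 'I_n.+1) * ('I_n.+1 * 'I_n.+1)) :
  (q.1.1 != q.1.2) || (q.2.1 != q.2.2) -> mean P (directions q) = 0.
Proof.
rewrite mean_directions => /orP[ab|ab].
  rewrite (bigD1 q.1.1)//= eqxx [q.1.2 == _]eq_sym (negbTE ab) addn0.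
  by rewrite (sphere_moment_odd (unifU _))// mul0r.
rewrite (bigD1 q.2.1)//= eqxx [q.2.2 == _]eq_sym (negbTE ab) addn0.
by rewrite (sphere_moment_odd (unifU _))// ?orbT// mul0r.
Qed.

(** Mean of the product of the squares of the first coordinate of direction [a]
    and the second coordinate of direction [b]. *)
Definition pair_weight n (a b : 'I_n) : R :=
  if a == b then (m%:R * (m%:R + 2))^-1 else (m%:R ^+ 2)^-1.

Lemma mean_directions_paired n (a b : 'I_n.+1) :
  mean P (directions ((a, a), (b, b))) = pair_weight a b.
Proof.
rewrite mean_directions /pair_weight /= (bigD1 a)//= eqxx.
have [->|ab] := eqVneq a b.
  rewrite (sphere_moment22 (unifU _))// big1 ?mulr1// => j jb.
  by rewrite eq_sym (negbTE jb) (sphere_moment0 (unifU _)).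
rewrite (bigD1 b) 1?eq_sym//= eqxx [b == a]eq_sym (negbTE ab).
rewrite (sphere_moment2 (unifU _))// sphere_momentC (sphere_moment2 (unifU _)) 1?eq_sym//.
rewrite big1 ?mulr1; first by rewrite expr2 invfM.
move=> j /andP[ja jb].
by rewrite [a == j]eq_sym (negbTE ja) [b == j]eq_sym (negbTE jb) (sphere_moment0 (unifU _)).
Qed.

Definition legs n (q : ('I_n.+1 * 'I_n.+1) * ('I_n.+1 * 'I_n.+1)) w : R :=
  leg n q.1.1 w * leg n q.1.2 w * (leg n q.2.1 w * leg n q.2.2 w).

Lemma mean_directions_legs n q :
  mean P (fun w => @directions n q w * legs q w) = mean P (directions q) * mean P (legs q).
Proof.
apply: (@mean_mul_independent2 _ _ _ P direction_sets (path_sets N)).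
- exact: random_flight_independent flight.
- exact: direction_sets_measurable.
- exact: path_sets_measurable.
- apply: bdd_prod => j; apply: (bdd_comp (measurable_direction j)).
  exact: bdd_sphere_monomial.
- by rewrite /legs; apply: bddM; apply: bddM; apply: bdd_leg; rewrite -ltnS.
Qed.

Let count_eq n := [set w | N t w = n].

Let measurable_count_eq n : measurable (count_eq n).
Proof.
rewrite (_ : count_eq n = N t @^-1` [set n])// -[X in measurable X]setTI.
exact: measurable_funP.
Qed.

Lemma directions_on_sphere : {ae P, forall w, forall j, esphere R m (U j w)}.
Proof.
apply/ae_foralln => j; exists (U j @^-1` (~` esphere R m)); split.
- rewrite -[X in measurable X]setTI; apply: measurable_funP => //.
  by apply: measurableC; exact: measurable_esphere.
- have mS : measurable (U j @^-1` esphere R m).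
    by rewrite -[X in measurable X]setTI; apply: measurable_funP => //; exact: measurable_esphere.
  have := probability_setC P mS; rewrite (uniform_sphere_as (unifU j)) => PC.
  by rewrite [LHS]PC subee.
- by move=> w.
Qed.

Let X k w := flight_position c N tau U t w ord0 k.

Lemma measurable_position_on_count n k : measurable_fun (count_eq n) (X k).
Proof.
apply: (eq_measurable_fun (fun w => c * \sum_(j < n.+1) leg n j w * (U j w : 'rV[R]_m) ord0 k)).
  by move=> w /set_mem Nn; rewrite /X (flight_position_legs _ Nn).
apply: measurable_funM => //; apply: measurable_sum => j; apply: measurable_funM.
  by apply: measurable_funTS; case: (@bdd_leg_ambient n j _) => //; rewrite -ltnS.
apply: measurable_funTS.
exact: (measurableT_comp (@measurable_coord R m k) (@measurable_funP _ _ _ _ _ (U j))).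
Qed.

Definition pair_sum n w : R :=
  c ^+ 4 * \sum_(a < n.+1) \sum_(b < n.+1) pair_weight a b * (leg n a w ^+ 2 * leg n b w ^+ 2).

(** With [n] fixed, the product of squares is a finite sum over quadruples of
    segments, and directions are independent of durations. *)
Lemma mean_flight_on_count n :
  (\int[P]_(w in count_eq n) (X i0 w ^+ 2 * X i1 w ^+ 2)%:E = (mean P (pair_sum n))%:E)%E.
Proof.
pose f w := c ^+ 4 * \sum_q @directions n q w * legs q w.
have bd q : bdd_measurable (fun w => @directions n q w * legs q w).
  apply: bddM.
    apply: bdd_prod => j; apply: bdd_comp; last exact: bdd_sphere_monomial.
    exact: measurable_funP.
  by rewrite /legs; apply: bddM; apply: bddM; apply: bdd_leg_ambient; rewrite -ltnS.
have bf : bdd_measurable f by apply: bddM; [exact: bdd_cst|exact: bdd_sum].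
have bdd_sqr (a b : 'I_n.+1) : bdd_measurable (fun w => leg n a w ^+ 2 * leg n b w ^+ 2).
  by rewrite /=; apply: bddM; apply: bddM; apply: bdd_leg_ambient; rewrite -ltnS.
have bdd_pair (a b : 'I_n.+1) :
    bdd_measurable (fun w => pair_weight a b * (leg n a w ^+ 2 * leg n b w ^+ 2)).
  by apply: bddM => //; exact: bdd_cst.
have meanf : mean P f = mean P (pair_sum n).
  rewrite /f meanZ; last exact: bdd_sum.
  rewrite mean_sum//.
  under eq_bigr do rewrite mean_directions_legs.
  rewrite sum_paired; last by move=> q pq; rewrite mean_directions_unpaired// mul0r.
  rewrite /pair_sum meanZ; last first.
    by apply: bdd_sum => a; apply: bdd_sum => b; exact: bdd_pair.
  rewrite mean_sum; last by move=> a; apply: bdd_sum => b; exact: bdd_pair.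
  congr (_ * _); apply: eq_bigr => a _; rewrite mean_sum//; apply: eq_bigr => b _.
  by rewrite meanZ// mean_directions_paired.
rewrite -meanf -meanE// integral_mkcond.
apply: ae_eq_integral => //.
- apply/(measurable_restrictT _ (measurable_count_eq n)).1/measurable_EFinP.
  by apply: measurable_funM; apply: measurable_funX; exact: measurable_position_on_count.
- by apply/measurable_EFinP; case: bf.
apply: filterS directions_on_sphere => w US _.
rewrite patchE; case: ifPn => [/set_mem Nn|].
  rewrite /X !(flight_position_legs _ Nn) !exprMn mulrACA -exprD sqr_sum_mul.
  congr (_ * _)%:E; apply: eq_bigr => q _; rewrite directionsE// /legs; ring.
move=> /negP nN; rewrite /f big1 ?mulr0// => q _.
rewrite /legs /leg; case: eqP => [Nn|_]; last by rewrite !mul0r mulr0.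
by exfalso; apply: nN; exact/mem_set.
Qed.

(** Mean of the product of squares when only the directions are averaged. *)
Definition path_moment w : R :=
  c ^+ 4 * ((m%:R ^+ 2)^-1 * duration_powersum N tau 2 t w ^+ 2 +
    ((m%:R * (m%:R + 2))^-1 - (m%:R ^+ 2)^-1) * duration_powersum N tau 4 t w).

(** The diagonal terms have another weight than the rest of the full double sum,
    which is the square of the sum of squares. *)
Lemma pair_sumE n w : pair_sum n w = (N t w == n)%:R * path_moment w.
Proof.
rewrite /pair_sum /path_moment; case: eqP => [Nn|Nn]; last first.
  rewrite mul0r big1 ?mulr0// => a _; rewrite big1// => b _.
  by rewrite /leg; case: eqP => // _; rewrite !mul0r expr0n /= mul0r mulr0.
rewrite mul1r; congr (_ * _); rewrite -!(sum_leg_pow _ Nn).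
rewrite [X in _ * X]expr2 big_distrlr /= mulr_sumr mulr_sumr -big_split /=.
apply: eq_bigr => a _; rewrite mulr_sumr (bigD1 a)//= [in RHS](bigD1 a)//= /pair_weight eqxx.
rewrite [RHS]addrAC; congr (_ + _); first by ring.
by apply: eq_bigr => b ba; rewrite eq_sym (negbTE ba).
Qed.

Lemma path_moment_ge0 w : 0 <= path_moment w.
Proof.
have := pair_sumE (N t w) w; rewrite eqxx mul1r => <-.
rewrite mulr_ge0//; first by rewrite -[4%N]/(2 * 2)%N exprM sqr_ge0.
apply: sumr_ge0 => a _; apply: sumr_ge0 => b _.
apply: mulr_ge0; last by apply: mulr_ge0; exact: sqr_ge0.
by rewrite /pair_weight; case: ifP => _; rewrite invr_ge0 ?mulr_ge0 ?exprn_ge0 ?addr_ge0.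
Qed.

Let bdd_sum2 : bdd_measurable (fun w => duration_powersum N tau 2 t w ^+ 2).
Proof.
split; first by apply: measurable_funX; exact: (measurable_duration_powersum jumpN).
exists (t ^+ 2 * t ^+ 2) => w; have /andP[a0 a1] := duration_powersum_bounds jumpN 1 w t0.
by rewrite ger0_norm ?sqr_ge0// ler_pM.
Qed.

Let bdd_sum4 : bdd_measurable (duration_powersum N tau 4 t).
Proof.
split; first exact: (measurable_duration_powersum jumpN).
exists (t ^+ 4) => w; have /andP[a0 a1] := duration_powersum_bounds jumpN 3 w t0.
by rewrite ger0_norm.
Qed.

Lemma bdd_path_moment : bdd_measurable path_moment.
Proof.
apply: bddM; first exact: bdd_cst.
by apply: bddD; apply: bddM => //; exact: bdd_cst.
Qed.

(** Both sides are split according to the number of jumps. *)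
Lemma integral_flight :
  (\int[P]_w (X i0 w ^+ 2 * X i1 w ^+ 2)%:E = (mean P path_moment)%:E)%E.
Proof.
have UE : \bigcup_n count_eq n = setT by apply/seteqP; split => // w _; exists (N t w).
have tE : trivIset setT count_eq by move=> i j _ _ [w [/= <- <-]].
have split_count (f : T -> R) : (forall n, measurable_fun (count_eq n) f) ->
    (forall w, 0 <= f w) ->
    (\int[P]_w (f w)%:E = \sum_(n <oo) \int[P]_(w in count_eq n) (f w)%:E)%E.
  move=> mf f0; rewrite -[in LHS]UE ge0_integral_bigcup//.
  - apply/measurable_EFinP/measurable_fun_bigcup => //.
  - by move=> w _; rewrite lee_fin.
rewrite split_count; last 2 first.
- by move=> n; apply: measurable_funM; apply: measurable_funX; exact: measurable_position_on_count.
- by move=> w; rewrite mulr_ge0 ?sqr_ge0.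
have bpm := bdd_path_moment.
rewrite -meanE// split_count; last 2 first.
- by move=> n; apply: measurable_funTS; case: bpm.
- exact: path_moment_ge0.
apply: eq_eseriesr => n _; rewrite mean_flight_on_count -meanE; last first.
  rewrite (_ : pair_sum n = fun w => \1_(count_eq n) w * path_moment w).
    by apply: bddM => //; exact: bdd_indic.
  apply/funext => w; rewrite pair_sumE indicE; congr (_%:R * _); congr nat_of_bool.
  by apply/eqP/idP => [?|/set_mem//]; exact/mem_set.
rewrite [RHS]integral_mkcond; apply: eq_integral => w _; rewrite patchE pair_sumE.
case: eqP => Nn; first by rewrite mem_set// mul1r.
by rewrite memNset// mul0r.
Qed.

Lemma mean_path_moment : mean P path_moment =
  c ^+ 4 * ((m%:R ^+ 2)^-1 * mean P (fun w => duration_powersum N tau 2 t w ^+ 2) +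
    ((m%:R * (m%:R + 2))^-1 - (m%:R ^+ 2)^-1) * mean P (duration_powersum N tau 4 t)).
Proof.
rewrite /path_moment meanZ; last by apply: bddD; apply: bddM => //; exact: bdd_cst.
by rewrite meanD ?meanZ//; apply: bddM => //; exact: bdd_cst.
Qed.

End Flight.

Theorem theorem1 (R : realType) (d : measure_display) (T : measurableType d)
    (P : probability T R) (m : nat) (c lambda : R)
    (N : R -> {RV P >-> nat}) (tau : nat -> T -> R)
    (U : nat -> {RV P >-> borel_rV R m}) :
  (3 <= m)%N -> 0 < c -> 0 < lambda -> random_flight lambda N tau U ->
  forall t : R, 0 < t ->
  moment P (flight_position c N tau U t)
    (fun i : 'I_m => if (i < 2)%N then 2%N else 0%N) =
  (8 * c ^+ 4 / (m%:R ^+ 2 * (m%:R + 2) * lambda ^+ 4) *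
   (m%:R * (expR (- (lambda * t)) *
              (lambda ^+ 2 * t ^+ 2 + 3 * lambda * t + 3)
            + lambda ^+ 2 * t ^+ 2 / 2 - 3)
    + (lambda ^+ 2 * t ^+ 2 + 12) * (1 - expR (- (lambda * t)))
    - 6 * lambda * t * (1 + expR (- (lambda * t)))))%:E.
Proof.
move=> m3 c0 lambda0 flight t t_gt0; have t0 := ltW t_gt0.
have lt0m : (0 < m)%N by exact: leq_trans m3.
have lt1m : (1 < m)%N by exact: leq_trans m3.
pose i0 := Ordinal lt0m; pose i1 := Ordinal lt1m.
have i01 : i0 != i1 by [].
rewrite /moment unlock.
transitivity (\int[P]_w (flight_position c N tau U t w ord0 i0 ^+ 2 *
    flight_position c N tau U t w ord0 i1 ^+ 2)%:E)%E.
  apply: eq_integral => w _; rewrite (bigD1 i0)//= (bigD1 i1)//=.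
  rewrite big1 ?mulr1// => i /andP[ii0 ii1]; case: ifP => // i2.
  by move: ii0 ii1; rewrite -!val_eqE /=; case: (val i) i2 => [|[|]].
rewrite (integral_flight c flight i01 t0) (mean_path_moment c flight)//.
rewrite (mean_duration_powersum2_sqr lambda0
  (random_flight_poisson flight) (random_flight_jumps flight))//.
rewrite (mean_duration_powersum4 lambda0
  (random_flight_poisson flight) (random_flight_jumps flight))//.
congr EFin; rewrite /survival.
have m0 : (m%:R : R) != 0 by rewrite pnatr_eq0 -lt0n.
have m2 : (m%:R + 2 : R) != 0 by rewrite gt_eqF// addr_gt0// ltr0n.
have l0 : lambda != 0 by rewrite gt_eqF.
by field; rewrite m0 m2 l0.
Qed.
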